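(* There is a randomized algorithm which, given a formula $\varphi(x_1,\dots,x_k)$ of bounded integer arithmetic (each free variable $x_i$ ranging over a given bounded integer interval $D_i=[a_i,b_i]\subseteq\mathbb{Z}$, existential quantifiers allowed at the top level) and a rational number $\varepsilon>0$, runs in time polynomial in $|\varphi|+\varepsilon^{-1}$, has oracle access to satisfiability of formulas of bounded integer arithmetic (each oracle query counting as one step), and outputs a value $A(\varphi,\varepsilon)$ such that $$\Pr\bigl[(1+\varepsilon)^{-1}\,\#\varphi \le A(\varphi,\varepsilon)\le (1+\varepsilon)\,\#\varphi\bigr]\ge 3/4,$$ where the probability is over the internal coin tosses of the algorithm. That is, the model counting problem for bounded integer arithmetic can be approximated with a multiplicative error by a polynomial-time randomized algorithm with such an oracle.
   Context: Bounded integer arithmetic: formulas of (not necessarily linear) integer arithmetic $\varphi(x_1,\dots,x_k)$ in which each free variable $x_i$ comes with a bounded domain $D_i=[a_i,b_i]\subseteq\mathbb{Z}$, $a_i,b_i\in\mathbb{Z}$, and existential (but no universal) quantifiers may occur at the top level. A model of $\varphi$ is a tuple $a\in D_1\times\dots\times D_k$ such that $\varphi(a)$ holds; $\#\varphi$ (the model count) is the number of models of $\varphi$ (the counting measure of its set of models). An oracle answers a satisfiability query (does a given formula of the theory have a model?) in a single time step. *)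

(* Defs.v *)
From mathcomp Require Import all_boot all_order all_algebra finmap.
From mathcomp Require Import boolp classical_sets functions cardinality.

Set Implicit Arguments.
Unset Strict Implicit.
Unset Printing Implicit Defensive.
Import Order.TTheory GRing.Theory Num.Theory.
Local Open Scope ring_scope.

Inductive term :=
  | TVar of nat
  | TConst of int
  | TAdd of term & term
  | TSub of term & term
  | TMul of term & term.

Inductive qfree :=
  | QEq of term & term
  | QLe of term & term
  | QNot of qfree
  | QAnd of qfree & qfree
  | QOr of qfree & qfree.

(* Variables are de Bruijn levels: in a formula with [k] free variables,
   [TVar i] is the [i]-th free variable if [i < k], and [TVar (k + j)] is the
   variable bound by the [j]-th quantifier of the prefix, outermost first. *)
Inductive prenex :=
  | PMatrix of qfree
  | PEx of prenex.

Record formula := Formula {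
  fdoms : seq (int * int);
  fbody : prenex }.

Fixpoint wf_term (n : nat) (t : term) : bool :=
  match t with
  | TVar i => (i < n)%N
  | TConst _ => true
  | TAdd s t | TSub s t | TMul s t => wf_term n s && wf_term n t
  end.

Fixpoint wf_qfree (n : nat) (f : qfree) : bool :=
  match f with
  | QEq s t | QLe s t => wf_term n s && wf_term n t
  | QNot g => wf_qfree n g
  | QAnd g h | QOr g h => wf_qfree n g && wf_qfree n h
  end.

Fixpoint wf_prenex (n : nat) (f : prenex) : bool :=
  match f with
  | PMatrix g => wf_qfree n g
  | PEx g => wf_prenex n.+1 g
  end.

Definition wf_formula (phi : formula) : bool :=
  wf_prenex (size (fdoms phi)) (fbody phi).

Fixpoint eval_term (a : seq int) (t : term) : int :=
  match t with
  | TVar i => nth 0 a i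
  | TConst c => c
  | TAdd s t => eval_term a s + eval_term a t
  | TSub s t => eval_term a s - eval_term a t
  | TMul s t => eval_term a s * eval_term a t
  end.

Fixpoint holds_qfree (a : seq int) (f : qfree) : bool :=
  match f with
  | QEq s t => eval_term a s == eval_term a t
  | QLe s t => eval_term a s <= eval_term a t
  | QNot g => ~~ holds_qfree a g
  | QAnd g h => holds_qfree a g && holds_qfree a h
  | QOr g h => holds_qfree a g || holds_qfree a h
  end.

Fixpoint holds (a : seq int) (f : prenex) : Prop :=
  match f with
  | PMatrix g => holds_qfree a g
  | PEx g => exists z : int, holds (rcons a z) g
  end.

(* [all2] also forces [a] to have one component per domain. *)
Definition in_doms (a : seq int) (ds : seq (int * int)) : bool :=
  all2 (fun (x : int) (d : int * int) => d.1 <= x <= d.2) a ds.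

Definition models (phi : formula) : set (seq int) :=
  [set a | in_doms a (fdoms phi) /\ holds a (fbody phi)].

Definition model_count (phi : formula) : nat := #|` fset_set (models phi)|.

(* [fset_set] returns the empty set on infinite sets; this does not happen. *)
Lemma finite_models (phi : formula) : finite_set (models phi).
Proof.
apply: (@sub_finite_set _ _ [set a | in_doms a (fdoms phi)]).
  by move=> a [].
elim: (fdoms phi) => [|[lo hi] ds IH].
  by apply: (@sub_finite_set _ _ [set [::]]) => // -[].
pose r := [seq lo + n%:Z | n <- iota 0 (absz (hi - lo)).+1].
have fr : finite_set [set` r] by exact: finite_seq.
apply: (@sub_finite_set _ _
  ((fun p : int * seq int => p.1 :: p.2) @`
     ([set` r] `*` [set a | in_doms a ds]))%classic).
  move=> [|x a] //= /andP[/andP[lox xhi] ads].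
  exists (x, a) => //; split => //=.
  have x0 : 0 <= x - lo by rewrite subr_ge0.
  have h0 : 0 <= hi - lo by rewrite subr_ge0 (le_trans lox).
  apply/mapP; exists (absz (x - lo)).
    by rewrite mem_iota add0n ltnS /= -lez_nat !gez0_abs // lerB.
  by rewrite gez0_abs // [RHS]addrC (@subrK int).
by apply: finite_image; apply: finite_setX.
Qed.

Definition satisfiable (phi : formula) : Prop := (models phi !=set0)%classic.

Inductive val :=
  | VInt of int
  | VPair of val & val.

(* Length of a written-out value; integers are written in binary with a sign. *)
Fixpoint vsize (v : val) : nat :=
  match v with
  | VInt z => (trunc_log 2 (absz z)).+2
  | VPair u w => (vsize u + vsize w).+1
  end.

Definition vtag (k : nat) (v : val) : val := VPair (VInt k%:Z) v.

Fixpoint enc_term (t : term) : val :=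
  match t with
  | TVar i => vtag 0 (VInt i%:Z)
  | TConst c => vtag 1 (VInt c)
  | TAdd s t => vtag 2 (VPair (enc_term s) (enc_term t))
  | TSub s t => vtag 3 (VPair (enc_term s) (enc_term t))
  | TMul s t => vtag 4 (VPair (enc_term s) (enc_term t))
  end.

Fixpoint enc_qfree (f : qfree) : val :=
  match f with
  | QEq s t => vtag 0 (VPair (enc_term s) (enc_term t))
  | QLe s t => vtag 1 (VPair (enc_term s) (enc_term t))
  | QNot g => vtag 2 (enc_qfree g)
  | QAnd g h => vtag 3 (VPair (enc_qfree g) (enc_qfree h))
  | QOr g h => vtag 4 (VPair (enc_qfree g) (enc_qfree h))
  end.

Fixpoint enc_prenex (f : prenex) : val :=
  match f with
  | PMatrix g => vtag 0 (enc_qfree g)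
  | PEx g => vtag 1 (enc_prenex g)
  end.

Fixpoint enc_doms (ds : seq (int * int)) : val :=
  match ds with
  | [::] => VInt 0
  | d :: ds => VPair (VPair (VInt d.1) (VInt d.2)) (enc_doms ds)
  end.

Definition enc_formula (phi : formula) : val :=
  VPair (enc_doms (fdoms phi)) (enc_prenex (fbody phi)).

Definition formula_size (phi : formula) : nat := vsize (enc_formula phi).

Lemma enc_term_inj : injective enc_term.
Proof.
elim=> [i|c|s IHs t IHt|s IHs t IHt|s IHs t IHt] [j|d|u w|u w|u w] //=.
- by case=> ->.
- by case=> ->.
- by case=> /IHs-> /IHt->.
- by case=> /IHs-> /IHt->.
- by case=> /IHs-> /IHt->.
Qed.

Lemma enc_qfree_inj : injective enc_qfree.
Proof.
elim=> [s t|s t|f IHf|f IHf g IHg|f IHf g IHg] [u w|u w|h|h k|h k] //=.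
- by case=> /enc_term_inj-> /enc_term_inj->.
- by case=> /enc_term_inj-> /enc_term_inj->.
- by case=> /IHf->.
- by case=> /IHf-> /IHg->.
- by case=> /IHf-> /IHg->.
Qed.

Lemma enc_prenex_inj : injective enc_prenex.
Proof.
elim=> [f|f IHf] [g|g] //=.
- by case=> /enc_qfree_inj->.
- by case=> /IHf->.
Qed.

Lemma enc_doms_inj : injective enc_doms.
Proof.
elim=> [|[x y] s IHs] [|[u w] t] //=.
by case=> -> -> /IHs->.
Qed.

Lemma enc_formula_inj : injective enc_formula.
Proof. by move=> [d f] [e g] [] /enc_doms_inj-> /enc_prenex_inj->. Qed.

(* A value that does not encode a well-formed formula is answered negatively. *)
Definition sat_oracle (v : val) : bool :=
  `[< exists phi, [/\ v = enc_formula phi, wf_formula phi & satisfiable phi] >].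

Definition enc_input (phi : formula) (eps : rat) : val :=
  VPair (enc_formula phi) (VPair (VInt (numq eps)) (VInt (denq eps))).

(* The fraction need not be reduced. *)
Definition represents (v : val) (q : rat) : Prop :=
  exists a b : int,
    [/\ v = VPair (VInt a) (VInt b), b != 0 & q = a%:~R / b%:~R].

(* First-order Lisp: a program is a list of mutually recursive one-argument
   functions.  [EVar i] is the [i]-th innermost variable in scope. *)
Inductive expr :=
  | EVar of nat
  | ELit of int
  | EAdd of expr & expr
  | ESub of expr & expr
  | ELeq of expr & expr
  | EPair of expr & expr
  | EFst of expr
  | ESnd of expr
  | EIsPair of expr
  | EIf of expr & expr & expr
  | ELet of expr & expr
  | ECall of nat & expr
  | EFlip
  | EQuery of expr.

Definition program := seq expr.

Definition body (P : program) (f : nat) : expr := nth (ELit 0) P f.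

Definition vbool (b : bool) : val := VInt (b : nat)%:Z.
Definition vint (v : val) : int := if v is VInt z then z else 0.
Definition vfst (v : val) : val := if v is VPair u _ then u else VInt 0.
Definition vsnd (v : val) : val := if v is VPair _ w then w else VInt 0.
Definition vispair (v : val) : bool := if v is VPair _ _ then true else false.
Definition vtrue (v : val) : bool := if v is VInt z then z != 0 else true.

(* [ev O P env e r v t r'] : with oracle [O], in program [P], the expression [e]
   evaluates to [v] in [t] steps, consuming a prefix of the list [r] of coin
   tosses and leaving [r'].  Every evaluation node is one step.  This measure is
   polynomially equivalent to Turing machine time: values are immutable and can
   be shared, and integers are only added, subtracted and compared, so that
   after [t] steps they are at most [t] bits longer than those of the input and
   program.  Since sharing can make the written-out form of a value exponentially
   long, a query is charged, besides the single step of the oracle's answer, for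
   writing the query down. *)
Inductive ev (O : val -> bool) (P : program) :
    seq val -> expr -> seq bool -> val -> nat -> seq bool -> Prop :=
  | EvVar env i r :
      ev O P env (EVar i) r (nth (VInt 0) env i) 1 r
  | EvLit env c r :
      ev O P env (ELit c) r (VInt c) 1 r
  | EvAdd env e1 e2 r r1 r2 v1 v2 t1 t2 :
      ev O P env e1 r v1 t1 r1 -> ev O P env e2 r1 v2 t2 r2 ->
      ev O P env (EAdd e1 e2) r (VInt (vint v1 + vint v2)) (t1 + t2).+1 r2
  | EvSub env e1 e2 r r1 r2 v1 v2 t1 t2 :
      ev O P env e1 r v1 t1 r1 -> ev O P env e2 r1 v2 t2 r2 ->
      ev O P env (ESub e1 e2) r (VInt (vint v1 - vint v2)) (t1 + t2).+1 r2
  | EvLeq env e1 e2 r r1 r2 v1 v2 t1 t2 :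
      ev O P env e1 r v1 t1 r1 -> ev O P env e2 r1 v2 t2 r2 ->
      ev O P env (ELeq e1 e2) r (vbool (vint v1 <= vint v2)) (t1 + t2).+1 r2
  | EvPair env e1 e2 r r1 r2 v1 v2 t1 t2 :
      ev O P env e1 r v1 t1 r1 -> ev O P env e2 r1 v2 t2 r2 ->
      ev O P env (EPair e1 e2) r (VPair v1 v2) (t1 + t2).+1 r2
  | EvFst env e r r1 v t :
      ev O P env e r v t r1 -> ev O P env (EFst e) r (vfst v) t.+1 r1
  | EvSnd env e r r1 v t :
      ev O P env e r v t r1 -> ev O P env (ESnd e) r (vsnd v) t.+1 r1
  | EvIsPair env e r r1 v t :
      ev O P env e r v t r1 ->
      ev O P env (EIsPair e) r (vbool (vispair v)) t.+1 r1
  | EvIf env e e1 e2 r r1 r2 v w t1 t2 :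
      ev O P env e r v t1 r1 ->
      ev O P env (if vtrue v then e1 else e2) r1 w t2 r2 ->
      ev O P env (EIf e e1 e2) r w (t1 + t2).+1 r2
  | EvLet env e1 e2 r r1 r2 v1 v2 t1 t2 :
      ev O P env e1 r v1 t1 r1 -> ev O P (v1 :: env) e2 r1 v2 t2 r2 ->
      ev O P env (ELet e1 e2) r v2 (t1 + t2).+1 r2
  | EvCall env f e r r1 r2 v w t1 t2 :
      ev O P env e r v t1 r1 -> ev O P [:: v] (body P f) r1 w t2 r2 ->
      ev O P env (ECall f e) r w (t1 + t2).+1 r2
  | EvFlip env b r :
      ev O P env EFlip (b :: r) (vbool b) 1 r
  | EvQuery env e r r1 v t :
      ev O P env e r v t r1 ->
      ev O P env (EQuery e) r (vbool (O v)) (t + vsize v).+1 r1.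

Lemma ev_det O P env e r v t r' v' t' r'' :
  ev O P env e r v t r' -> ev O P env e r v' t' r'' ->
  [/\ v = v', t = t' & r' = r''].
Proof.
move=> H; move: v' t' r''.
elim: H => {env e r v t r'}
  [env i r|env c r
  |env e1 e2 r r1 r2 v1 v2 t1 t2 _ IH1 _ IH2
  |env e1 e2 r r1 r2 v1 v2 t1 t2 _ IH1 _ IH2
  |env e1 e2 r r1 r2 v1 v2 t1 t2 _ IH1 _ IH2
  |env e1 e2 r r1 r2 v1 v2 t1 t2 _ IH1 _ IH2
  |env e r r1 v t _ IH|env e r r1 v t _ IH|env e r r1 v t _ IH
  |env e e1 e2 r r1 r2 v w t1 t2 _ IH1 _ IH2
  |env e1 e2 r r1 r2 v1 v2 t1 t2 _ IH1 _ IH2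
  |env f e r r1 r2 v w t1 t2 _ IH1 _ IH2
  |env b r|env e r r1 v t _ IH] v' t' r'' H; inversion H; subst=> //.
all: try by match goal with
  | h1 : ev _ _ _ _ _ _ _ _, h2 : ev _ _ _ _ _ _ _ _ |- _ =>
      case: (IH1 _ _ _ h1) => ? ? ?; subst;
      case: (IH2 _ _ _ h2) => ? ? ?; subst
  end.
all: by match goal with
  | h1 : ev _ _ _ _ _ _ _ _ |- _ => case: (IH _ _ _ h1) => ? ? ?; subst
  end.
Qed.

Definition run (A : program) (phi : formula) (eps : rat) (r : seq bool)
    (q : rat) (t : nat) : Prop :=
  exists v r', ev sat_oracle A [:: enc_input phi eps] (body A 0) r v t r' /\
               represents v q.

Definition prob_coins (T : nat) (E : seq bool -> Prop) : rat :=
  #|[set r : T.-tuple bool | `[< E r >]]%SET|%:R / 2%:R ^+ T.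

(* Main.v *)
Require Import Defs.
From mathcomp Require Import all_boot all_order all_algebra finmap.
From mathcomp Require Import boolp cardinality.
From mathcomp Require Import zify ring lra.

(* A model is packed injectively into a natural number [X < 2 ^ w] by a mixed radix
   expansion.  Take [P = 2 ^ (2 w + 1)] and uniform [a, b < P]; the hash value
   [(a X + b) mod P] lies in the cell of level [m], that is below [P / 2 ^ m], with
   probability exactly [2 ^ - m], and for [m <= w] these events are pairwise
   independent for different [X].  The oracle decides whether a cell contains at
   least [t] models: ask for [t] copies of the formula whose packed values increase.
   With [e - 1 >= 1 / eps] and a threshold of [32 e ^ 2], output [2 ^ m] times the
   size of the first cell, in order of increasing [m], below the threshold.  By
   Chebyshev's inequality and a union bound over the levels [m] with
   [2 ^ (m + 3) e ^ 2 <= #phi], whose failure probabilities form a geometric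
   progression, the cell sizes are all within a factor [1 +- 1 / e] of their
   expectation with probability at least [3 / 4]; and then the search stops at one
   of these levels (if there is none, at level 0, where the count is exact). *)

Set Implicit Arguments.
Unset Strict Implicit.
Unset Printing Implicit Defensive.
Import Order.TTheory GRing.Theory Num.Theory.
Local Open Scope nat_scope.

(** * Pairwise independence of the hash *)

Definition in_cell (P M a b X : nat) : bool := (a * X + b) %% P * M < P.

(** The residues modulo [M * K] form [M] blocks of length [K]; adding [K] permutes the blocks
    cyclically, so exactly one of the [M] shifts of [v] falls into the first block. *)
Lemma sum_block_shifts (M K v : nat) : 0 < M -> 0 < K ->
  \sum_(j < M) ((v + j * K) %% (M * K) < K : nat) = 1.
Proof.
move=> M0 K0.
have E (j : nat) : ((v + j * K) %% (M * K) < K) = ((v %/ K + j) %% M == 0).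
  rewrite -[X in _ < X]mul1n -ltn_divLR // -modn_divl divnDMl // ltnS leqn0 //.
have jM : (M - (v %/ K) %% M) %% M < M by rewrite ltn_mod.
rewrite (bigD1 (Ordinal jM)) //= E modnDmr -modnDml subnKC ?modnn ?eqxx; last first.
  by rewrite ltnW ?ltn_mod.
rewrite big1 ?addn0 // => j /negP nj; rewrite E; case: eqP => // h; case: nj.
apply/eqP/val_inj => /=.
have lj := ltn_ord j; have := ltn_pmod (v %/ K) M0; move: h.
rewrite -modnDml; set a := (v %/ K) %% M => h la.
case: (posnP a) => [a0|a0].
  by move: h; rewrite a0 subn0 modnn add0n modn_small.
rewrite modn_small; last by lia.
have [lt|ge] := ltnP (a + j) M; first by move: h; rewrite modn_small //; lia.
have : (a + j - M) %% M = 0 by rewrite -[RHS]h -[in RHS](subnK ge) modnDr.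
by rewrite modn_small; lia.
Qed.

Section Hash.
Variables (p M K : nat).
Hypotheses (M0 : 0 < M) (K0 : 0 < K) (pMK : p.+2 = M * K).
Local Notation Zp := ('I_p.+2).

(** Translating [x] by [j * c] moves the value by [j * K] and leaves the sum unchanged; summed over
    [j < M], each [x] contributes one hit by [sum_block_shifts]. The slope [d] may be a zero
    divisor, as long as it divides [K]. *)
Lemma sum_progression (u d c : Zp) : (d * c)%R = K%:R%R ->
  M * (\sum_(x : Zp) ((u + d * x)%R < K : nat)) = p.+2.
Proof.
move=> dc; pose f (y : Zp) : nat := ((u + d * y)%R < K).
rewrite -[LHS](_ : \sum_(j < M) \sum_x f x = _); last first.
  by rewrite sum_nat_const card_ord.
have E (j : 'I_M) : true -> \sum_x f x = \sum_x f (x + j%:R * c)%R.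
  by move=> _; exact: (reindex_inj (@addIr Zp (j%:R * c)%R)).
rewrite (eq_bigr _ E) exchange_big /=.
rewrite (eq_bigr (fun _ => 1)) ?sum1_card ?card_ord // => x _.
rewrite -[RHS](@sum_block_shifts M K (u + d * x)%R) //; apply: eq_bigr => j _.
rewrite /f mulrDr mulrCA dc addrA -natrM -pMK.
congr (nat_of_bool (_ < K)).
have -> : ((u + d * x) + (j * K)%:R)%R = ((u + d * x)%R + j * K)%:R%R :> Zp.
  by rewrite [in RHS]natrD natr_Zp.
by rewrite (@val_Zp_nat p.+2).
Qed.

Lemma in_cellE (a b : Zp) (X : nat) :
  in_cell p.+2 M a b X = ((a * X%:R + b)%R < K) :> bool.
Proof.
have -> : (a * X%:R + b)%R = (a * X + b)%:R%R :> Zp.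
  by rewrite natrD natrM !natr_Zp.
rewrite (@val_Zp_nat p.+2) // /in_cell.
set r := _ %% _; by rewrite pMK [M * K]mulnC ltn_pmul2r.
Qed.

Lemma sum_in_cell (X : nat) :
  M * (\sum_(a : Zp) \sum_(b : Zp) (in_cell p.+2 M a b X : nat)) = p.+2 * p.+2.
Proof.
rewrite big_distrr /= -[RHS](_ : \sum_(a : Zp) p.+2 = _); last first.
  by rewrite sum_nat_const card_ord.
apply: eq_bigr => a _.
rewrite -[RHS](@sum_progression (a * X%:R)%R 1%R K%:R%R) ?mul1r //.
by congr (_ * _); apply: eq_bigr => b _; rewrite in_cellE mul1r.
Qed.

(** For fixed [a], the substitution [u = a X + b] turns the two hash values into [u] and
    [u + (Y - X) a]; for each [u], the latter runs through a progression in [a], to which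
    [sum_progression] applies. *)
Lemma sum_in_cell2 (X Y : nat) (c : Zp) : ((Y%:R - X%:R) * c)%R = K%:R%R ->
  M * M * (\sum_(a : Zp) \sum_(b : Zp)
     (in_cell p.+2 M a b X && in_cell p.+2 M a b Y : nat)) = p.+2 * p.+2.
Proof.
move=> dc.
have -> : \sum_(a : Zp) \sum_(b : Zp)
     (in_cell p.+2 M a b X && in_cell p.+2 M a b Y : nat)
  = \sum_(u : Zp) (u < K : nat) *
      \sum_(a : Zp) ((u + (Y%:R - X%:R) * a)%R < K : nat).
  under [RHS]eq_bigr => u _ do rewrite big_distrr.
  rewrite [RHS]exchange_big; apply: eq_bigr => a _.
  rewrite [RHS](reindex_inj (@addrI Zp (a * X%:R)%R)); apply: eq_bigr => b _.
  have E : (a * X%:R + b + (Y%:R - X%:R) * a = a * Y%:R + b)%R by ring.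
  by rewrite !in_cellE -mulnb -[(a * Y%:R + b)%R]E.
rewrite -mulnA (big_distrr M) /=.
under eq_bigr => u _ do rewrite mulnCA (sum_progression _ dc).
rewrite -big_distrl /= mulnA; congr (_ * _).
rewrite -[RHS](@sum_progression 0%R 1%R K%:R%R) ?mul1r //.
by congr (_ * _); apply: eq_bigr => b _; rewrite mul1r add0r.
Qed.

End Hash.

(* The gcd of [Y - X] with the modulus is a power of two below [2 ^ w], so it divides
   the right-hand side; [c] then comes from Bezout. *)
Lemma cell_step (p w m X Y : nat) : p.+2 = 2 ^ (w + w).+1 -> m <= w ->
  X < 2 ^ w -> Y < 2 ^ w -> X != Y ->
  exists c : 'I_p.+2,
    ((Y%:R - X%:R) * c)%R = ((2 ^ ((w + w).+1 - m))%:R : 'I_p.+2)%R.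
Proof.
move=> pE mw.
wlog XY : X Y / X < Y => [H|] Xw Yw nXY.
  have [XY|YX|E] := ltngtP X Y; [exact: H | | by rewrite E eqxx in nXY].
  have [|c cE] := H Y X YX Yw Xw; first by rewrite eq_sym.
  by exists (- c)%R; rewrite -cE; ring.
set D := Y - X; have D0 : 0 < D by rewrite subn_gt0.
have [k _ /dvdnP[l lE]] := Bezoutr D (isT : 0 < p.+2).
have /dvdn_pfactor-/(_ isT)[s sL gE] : gcdn D p.+2 %| 2 ^ (w + w).+1.
  by rewrite -pE dvdn_gcdr.
have sw : s < w.
  rewrite -(@ltn_exp2l 2) // -gE (leq_ltn_trans (dvdn_leq D0 (dvdn_gcdl _ _))) //.
  by rewrite (leq_ltn_trans (leq_subr _ _)).
set t := (w + w).+1 - m.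
(* From [m <= w] follows [w < t], so [2 ^ s], with [s < w], divides [2 ^ t]. *)
have st : s <= t by rewrite /t; lia.
have Dk : (D%:R * k%:R = - (2 ^ s)%:R :> 'I_p.+2)%R.
  apply/eqP; rewrite eq_sym -subr_eq0 -opprD oppr_eq0 -natrM -natrD -gE [D * k]mulnC lE.
  by rewrite natrM (@pchar_Zp p.+2) // mulr0.
exists (- (k%:R * (2 ^ (t - s))%:R))%R.
rewrite -natrB ?(ltnW XY) // -/D mulrN mulrA Dk mulNr opprK -natrM -expnD.
by rewrite subnKC.
Qed.

(** * Concentration of the cell sizes *)

Definition dist (m n : nat) := (m - n) + (n - m).

Section Chebyshev.
Variables (W : finType) (I : W -> pred nat) (l : seq nat) (M : nat).
Hypotheses (l_uniq : uniq l)
  (single : forall X, X \in l -> M * (\sum_w (I w X : nat)) = #|W|)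
  (pair : forall X Y, X \in l -> Y \in l -> X != Y ->
     M * M * (\sum_w (I w X && I w Y : nat)) = #|W|).

Lemma countE (w : W) : count (I w) l = \sum_(X <- l) (I w X : nat).
Proof. by rewrite -sum1_count big_mkcond; apply: eq_bigr => X _; case: ifP. Qed.

Lemma sum_count : M * (\sum_w count (I w) l) = size l * #|W|.
Proof.
under eq_bigr => w _ do rewrite countE.
rewrite exchange_big big_distrr /= big_seq_cond.
under eq_bigr => X /andP[Xl _] do rewrite (single Xl).
by rewrite -big_seq_cond big_const_seq count_predT iter_addn_0 mulnC.
Qed.

(** The square of the count expands into ordered pairs: with [N = size l], there are [N] diagonal
    ones of weight [M * #|W|] and [N (N - 1)] others of weight [#|W|]. The negative term is moved to
    the left. *)
Lemma sum_count2 :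
  M * M * (\sum_w count (I w) l ^ 2) + size l * #|W| =
  size l * M * #|W| + size l * size l * #|W|.
Proof.
have E : M * M * (\sum_w count (I w) l ^ 2) =
    \sum_(X <- l) \sum_(Y <- l) M * M * (\sum_w (I w X && I w Y : nat)).
  rewrite big_distrr /=.
  have F w : M * M * count (I w) l ^ 2 =
      \sum_(X <- l) \sum_(Y <- l) M * M * (I w X && I w Y : nat).
    rewrite countE expnS expn1 big_distrl big_distrr /=; apply: eq_bigr => X _.
    by rewrite !big_distrr /=; apply: eq_bigr => Y _; rewrite mulnb.
  under eq_bigr => w _ do rewrite F.
  rewrite exchange_big /=; apply: eq_bigr => X _.
  by rewrite exchange_big /=; apply: eq_bigr => Y _; rewrite big_distrr.
rewrite {}E.
have G X : X \in l ->
    \sum_(Y <- l) M * M * (\sum_w (I w X && I w Y : nat)) + #|W| =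
    M * #|W| + size l * #|W|.
  move=> Xl; rewrite (bigD1_seq X) //=; under eq_bigr => w _ do rewrite andbb.
  rewrite -mulnA (single Xl) -addnA; congr (_ + _).
  rewrite big_seq_cond (eq_bigr (fun=> #|W|)) => [|Y /andP[Yl YX]]; last first.
    by rewrite pair // eq_sym.
  rewrite -big_seq_cond -(count_predC (pred1 X)) count_uniq_mem // Xl mulnDl mul1n addnC.
  by rewrite big_const_seq iter_addn_0 mulnC.
rewrite -{1}[size l]sum1_size big_distrl -big_split /= big_seq.
under eq_bigr => X Xl do rewrite mul1n G //.
by rewrite -big_seq big_const_seq count_predT iter_addn_0 mulnC mulnDr !mulnA.
Qed.

(** The summed squared deviation is at most [N M #|W|], and each [w] in the exceptional set
    contributes more than [(N / e) ^ 2]. *)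
Lemma chebyshev (e : nat) :
  #|[set w | size l < e * dist (M * count (I w) l) (size l)]| * size l
  <= #|W| * M * e ^ 2.
Proof.
set N := size l; set B := [set w | _].
have [->|N0] := posnP N; first by rewrite muln0.
have S : \sum_w dist (M * count (I w) l) N ^ 2 <= N * M * #|W|.
  have := sum_count; have := sum_count2; rewrite -/N => E2 E1.
  have D : \sum_w dist (M * count (I w) l) N ^ 2
      + 2 * N * (M * \sum_w count (I w) l) =
      M * M * (\sum_w count (I w) l ^ 2) + N * N * #|W|.
    rewrite -sum1_card !big_distrr /= -!big_split /=; apply: eq_bigr => w _.
    by rewrite /dist; move: (count _ _) => y; nia.
  move: D; rewrite E1; nia.
rewrite -(leq_pmul2r N0).
have H : #|B| * N * N <= e ^ 2 * (\sum_w dist (M * count (I w) l) N ^ 2).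
  rewrite -sum1_card -mulnA big_distrl big_distrr /=.
  rewrite [X in _ <= X](bigID (mem B)) /= (leq_trans _ (leq_addr _ _)) //.
  apply: leq_sum => w; rewrite inE -/N => h; rewrite mul1n -expnMn expnS expn1.
  by rewrite leq_mul // ltnW.
apply: leq_trans H _; apply: leq_trans (leq_mul (leqnn _) S) _; nia.
Qed.

End Chebyshev.

(** * The search for the level *)

(** Here [M] is the current [2 ^ m] and [fuel] the number of levels left. The count is capped at
    [thr] because the program asks the oracle for at most [thr] models per cell. *)
Fixpoint approx (P thr a b : nat) (l : seq nat) (fuel M : nat) : nat :=
  let r := minn thr (count (in_cell P M a b) l) in
  if fuel is fuel'.+1 then
    if thr <= r then approx P thr a b l fuel' (M + M) else r * M
  else r * M.

(** The search cannot pass a level whose cell is below the threshold, and wherever it stops up to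
    level [m] the cap is inactive, so the count is the true one. *)
Lemma approx_stop (P thr a b : nat) (l : seq nat) (fuel j m : nat) :
  j <= m <= j + fuel -> count (in_cell P (2 ^ m) a b) l < thr ->
  exists2 i, i <= m &
    approx P thr a b l fuel (2 ^ j) = count (in_cell P (2 ^ i) a b) l * 2 ^ i.
Proof.
elim: fuel j => [|fuel IH] j /andP[jm mj] cm /=.
  have -> : j = m by apply/eqP; rewrite eqn_leq jm -[j]addn0.
  by exists m => //; rewrite (minn_idPr (ltnW cm)).
have [ge|lt] := leqP thr (minn thr (count (in_cell P (2 ^ j) a b) l)); last first.
  exists j => //; congr (_ * _); apply/minn_idPr.
  by rewrite ltnW //; move: lt; rewrite gtn_min ltnn.
have jm' : j < m.
  move: jm; rewrite leq_eqVlt => /predU1P[E|//].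
  by move: ge; rewrite leqNgt gtn_min E cm orbT.
by rewrite addnn -mul2n -expnS; apply: IH => //; rewrite jm' addSnnS.
Qed.

(** A union bound: the failure bounds double with the level, so their sum is at most twice the last
    one. *)
Lemma bigcup_bound (W : finType) (B : nat -> {set W}) (N C m : nat) :
  (forall j, j <= m -> #|B j| * N <= C * 2 ^ j) ->
  #|\bigcup_(j < m.+1) B j| * N <= C * 2 ^ m.+1.
Proof.
move=> H; have {H} : forall j, j < m.+1 -> #|B j| * N <= C * 2 ^ j by [].
elim: m.+1 => [|k IH] H; first by rewrite big_ord0 cards0.
rewrite big_ord_recr /= (leq_trans (leq_mul (leq_card_setU _ _) (leqnn _))) //.
rewrite mulnDl expnS mul2n -addnn mulnDr leq_add // ?H //.
by apply: IH => j jk; apply: H; rewrite ltnS ltnW.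
Qed.

Section HashCount.
Variables (p w : nat) (l : seq nat).
Hypotheses (pE : p.+2 = 2 ^ (w + w).+1) (l_uniq : uniq l)
  (l_bound : forall X, X \in l -> X < 2 ^ w).

Lemma hash_chebyshev (m e : nat) : m <= w ->
  #|[set c : 'I_p.+2 * 'I_p.+2 | size l <
       e * dist (2 ^ m * count (in_cell p.+2 (2 ^ m) c.1 c.2) l) (size l)]|
    * size l <= (p.+2 * p.+2 * e ^ 2) * 2 ^ m.
Proof.
move=> mw; have M0 : 0 < 2 ^ m by rewrite expn_gt0.
have K0 : 0 < 2 ^ ((w + w).+1 - m) by rewrite expn_gt0.
have pMK : p.+2 = 2 ^ m * 2 ^ ((w + w).+1 - m).
  by rewrite pE -expnD subnKC //; lia.
have card : #|{: 'I_p.+2 * 'I_p.+2}| = p.+2 * p.+2 by rewrite card_prod card_ord.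
have H1 X : X \in l -> 2 ^ m * (\sum_(c : 'I_p.+2 * 'I_p.+2)
    (in_cell p.+2 (2 ^ m) c.1 c.2 X : nat)) = #|{: 'I_p.+2 * 'I_p.+2}|.
  move=> _; rewrite card -(sum_in_cell M0 K0 pMK X); congr (_ * _).
  by rewrite [RHS]pair_bigA.
have H2 X Y : X \in l -> Y \in l -> X != Y -> 2 ^ m * 2 ^ m *
    (\sum_(c : 'I_p.+2 * 'I_p.+2) (in_cell p.+2 (2 ^ m) c.1 c.2 X &&
       in_cell p.+2 (2 ^ m) c.1 c.2 Y : nat)) = #|{: 'I_p.+2 * 'I_p.+2}|.
  move=> Xl Yl XY.
  have [c cE] := cell_step pE mw (l_bound Xl) (l_bound Yl) XY.
  rewrite card -(sum_in_cell2 M0 K0 pMK cE); congr (_ * _).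
  by rewrite [RHS]pair_bigA.
have := chebyshev l_uniq H1 H2 e; rewrite card => H.
by apply: leq_trans H _; rewrite mulnAC.
Qed.

Lemma size_bound : size l <= 2 ^ w.
Proof.
rewrite -(size_iota 0 (2 ^ w)); apply: uniq_leq_size => // X /l_bound.
by rewrite mem_iota.
Qed.

Lemma approx_correct (e : nat) : 0 < e ->
  3 * (p.+2 * p.+2) <= 4 * #|[set c : 'I_p.+2 * 'I_p.+2 |
     e * dist (approx p.+2 (32 * (e * e)) c.1 c.2 l w 1) (size l) <= size l]|.
Proof.
move=> e0; set N := size l; set G := [set _ | _].
have card : #|{: 'I_p.+2 * 'I_p.+2}| = p.+2 * p.+2 by rewrite card_prod card_ord.
have [small|big] := ltnP N (8 * (e * e)).
  suff -> : G = setT by rewrite cardsT card leq_mul.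
  apply/setP => c; rewrite !inE.
  have -> : approx p.+2 (32 * (e * e)) c.1 c.2 l w 1 = N.
    have cN : count (in_cell p.+2 (2 ^ 0) c.1 c.2) l = N.
      by apply/eqP; rewrite -all_count; apply/allP => X _; rewrite /in_cell muln1 ltn_mod.
    have [||i] := @approx_stop p.+2 (32 * (e * e)) c.1 c.2 l w 0 0.
    - by rewrite leq0n.
    - by rewrite cN; lia.
    by rewrite leqn0 => /eqP-> ->; rewrite cN muln1.
  by rewrite /dist subnn muln0.
have D0 : 0 < 8 * (e * e) by rewrite !muln_gt0 e0.
have Q0 : 0 < N %/ (8 * (e * e)) by rewrite divn_gt0.
(* The last level on which concentration is used: the largest [m] with
   [2 ^ m * (8 * (e * e)) <= N]. *)
set m := trunc_log 2 (N %/ (8 * (e * e))).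
have mle : 2 ^ m * (8 * (e * e)) <= N by rewrite -leq_divRL // trunc_logP.
have mlt : N < 2 ^ m.+1 * (8 * (e * e)) by rewrite -ltn_divLR // trunc_log_ltn.
have mw : m <= w.
  rewrite -(@leq_exp2l 2) // (leq_trans _ size_bound) // (leq_trans _ mle) //.
  by rewrite leq_pmulr.
pose B j := [set c : 'I_p.+2 * 'I_p.+2 | N <
       e * dist (2 ^ j * count (in_cell p.+2 (2 ^ j) c.1 c.2) l) N].
set U := \bigcup_(j < m.+1) B j.
have UB : 4 * #|U| <= p.+2 * p.+2.
  have HB j : j <= m -> #|B j| * N <= (p.+2 * p.+2 * e ^ 2) * 2 ^ j.
    by move=> jm; apply: hash_chebyshev (leq_trans jm mw).
  have := bigcup_bound HB; rewrite -/U => H.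
  have N0 : 0 < N by exact: leq_trans D0 big.
  rewrite -(leq_pmul2r N0) -mulnA.
  (* The factor 8 in the choice of [m] is [4 * 2]: one quarter is the allowed failure probability,
     and the sum over the levels costs a factor 2. *)
  apply: leq_trans (leq_mul (leqnn 4) H) _.
  apply: leq_trans (leq_mul (leqnn (p.+2 * p.+2)) mle).
  rewrite -mulnn expnS; move: (2 ^ m) (p.+2 * p.+2) => x y.
  by rewrite eq_leq //; ring.
have UG : ~: U \subset G.
  apply/subsetP => c; rewrite inE => cU; rewrite inE.
  have good j : j <= m ->
      e * dist (2 ^ j * count (in_cell p.+2 (2 ^ j) c.1 c.2) l) N <= N.
    move=> jm; rewrite leqNgt; apply: contra cU => cB.
    by apply/bigcupP; exists (Ordinal (jm : j < m.+1)) => //; rewrite inE.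
  have cm : count (in_cell p.+2 (2 ^ m) c.1 c.2) l < 32 * (e * e).
    rewrite ltnNge; apply/negP => ge.
    have := good m (leqnn m); rewrite leqNgt => /negP; apply.
    rewrite -[X in X < _]mul1n.
    (* By maximality of [m], [N] is below [16 e ^ 2] times [2 ^ m], so a count of [32 e ^ 2] would
       scale to more than [2 N], a deviation above [N]. *)
    have : 2 * N < 2 ^ m * count (in_cell p.+2 (2 ^ m) c.1 c.2) l.
      apply: leq_trans (leq_mul (leqnn _) ge).
      by move: mlt; rewrite expnS; move: (2 ^ m) => x; lia.
    rewrite /dist; move: (_ * count _ _) => y h.
    by apply: leq_trans (leq_mul e0 (leqnn _)); lia.
  have [|i im ->] := @approx_stop p.+2 (32 * (e * e)) c.1 c.2 l w 0 m _ cm.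
    by rewrite add0n mw.
  by rewrite [_ * 2 ^ i]mulnC; exact: good.
have := subset_leq_card UG; have := cardsC U; rewrite card; lia.
Qed.

End HashCount.

(** * Coin tosses *)

(** The first toss is the least significant bit, which is the order in which [rnd_body] assembles
    the number. *)
Fixpoint bits (L : nat) (r : seq bool) : nat :=
  if L is L'.+1 then head false r + (bits L' (behead r)).*2 else 0.

Lemma bits_lt L r : bits L r < 2 ^ L.
Proof.
elim: L r => [|L IH] r //=; have := IH (behead r); rewrite expnS.
by case: (head _ _); lia.
Qed.

Lemma sum_tuple_cons n (F : seq bool -> nat) :
  \sum_(r : n.+1.-tuple bool) F r =
  \sum_(r : n.-tuple bool) F (false :: r) + \sum_(r : n.-tuple bool) F (true :: r).
Proof.
pose h (c : bool * n.-tuple bool) : n.+1.-tuple bool := [tuple of c.1 :: c.2].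
have hb : bijective h.
  exists (fun t : n.+1.-tuple bool => (thead t, [tuple of behead t])).
    by case=> b t; congr (_, _); apply/val_inj.
  by move=> t; apply/val_inj; rewrite /= [in RHS](tuple_eta t).
rewrite (reindex h) /=; last exact: onW_bij.
by rewrite -(pair_bigA _ (fun b (t : n.-tuple bool) => F (b :: t))) /= big_bool addnC.
Qed.

Lemma sum_double n (F : nat -> nat) :
  \sum_(a < n.*2) F a = \sum_(a < n) F a.*2 + \sum_(a < n) F a.*2.+1.
Proof.
elim: n => [|n IH]; first by rewrite !big_ord0.
by rewrite doubleS !big_ord_recr /= IH [RHS]addnACA addnA.
Qed.

Lemma sum_bits L n (F : nat -> seq bool -> nat) :
  \sum_(r : (L + n).-tuple bool) F (bits L r) (drop L r) =
  \sum_(a < 2 ^ L) \sum_(r : n.-tuple bool) F a r.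
Proof.
elim: L F => [|L IH] F.
  by rewrite big_ord1; apply: eq_bigr => r _; rewrite drop0.
rewrite (sum_tuple_cons (L + n) (fun r => F (bits L.+1 r) (drop L.+1 r))) /=.
rewrite (IH (fun a => F (false + a.*2))) (IH (fun a => F (true + a.*2))).
by rewrite expnS mul2n (sum_double _ (fun a => \sum_(r : n.-tuple bool) F a r)).
Qed.

(** Two numbers are read; the [n] tosses after them are free and account for the factor [2 ^ n]. *)
Lemma card_bits2 L n (G : nat -> nat -> bool) :
  #|[set r : (L + (L + n)).-tuple bool | G (bits L r) (bits L (drop L r))]| =
  #|[set c : 'I_(2 ^ L) * 'I_(2 ^ L) | G c.1 c.2]| * 2 ^ n.
Proof.
rewrite -!sum1_card big_mkcond [in RHS]big_mkcond /=.
under eq_bigr => r _ do rewrite inE.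
rewrite (sum_bits L (L + n) (fun a r => if G a (bits L r) then 1 else 0)).
under [in RHS]eq_bigr => c _ do rewrite inE.
rewrite -(pair_bigA _ (fun a b : 'I_(2 ^ L) => if G a b then 1 else 0)) big_distrl /=.
apply: eq_bigr => a _.
rewrite (sum_bits L n (fun b _ => if G a b then 1 else 0)) big_distrl /=.
apply: eq_bigr => b _; rewrite sum_nat_const card_tuple card_bool.
by rewrite mulnC.
Qed.

(** * Packing models into natural numbers *)

Fixpoint shift_term (o : nat) (t : term) : term :=
  match t with
  | TVar i => TVar (i + o)
  | TConst c => TConst c
  | TAdd s t => TAdd (shift_term o s) (shift_term o t)
  | TSub s t => TSub (shift_term o s) (shift_term o t)
  | TMul s t => TMul (shift_term o s) (shift_term o t)
  end.

Fixpoint shift_qfree (o : nat) (f : qfree) : qfree :=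
  match f with
  | QEq s t => QEq (shift_term o s) (shift_term o t)
  | QLe s t => QLe (shift_term o s) (shift_term o t)
  | QNot g => QNot (shift_qfree o g)
  | QAnd g h => QAnd (shift_qfree o g) (shift_qfree o h)
  | QOr g h => QOr (shift_qfree o g) (shift_qfree o h)
  end.

Lemma eval_shift o a t : eval_term a (shift_term o t) = eval_term (drop o a) t.
Proof.
elim: t => //= [i|s -> t ->|s -> t ->|s -> t ->] //.
by rewrite nth_drop addnC.
Qed.

Lemma holds_shift o a f : holds_qfree a (shift_qfree o f) = holds_qfree (drop o a) f.
Proof.
by elim: f => //= [s t|s t|g ->|g -> h ->|g -> h ->] //; rewrite !eval_shift.
Qed.

Lemma wf_term_shift n o t : wf_term n t -> wf_term (n + o) (shift_term o t).
Proof.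
elim: t => //= [i|s IHs t IHt|s IHs t IHt|s IHs t IHt]; first by rewrite ltn_add2r.
all: by move=> /andP[/IHs-> /IHt->].
Qed.

Lemma wf_shift n o f : wf_qfree n f -> wf_qfree (n + o) (shift_qfree o f).
Proof.
elim: f => //= [s t|s t|g IHg h IHh|g IHg h IHh].
1,2: by move=> /andP[/(wf_term_shift o)-> /(wf_term_shift o)->].
all: by move=> /andP[/IHg-> /IHh->].
Qed.

Lemma wf_term_mono n m t : n <= m -> wf_term n t -> wf_term m t.
Proof.
move=> nm; elim: t => //= [i|s IHs t IHt|s IHs t IHt|s IHs t IHt].
  by move=> /leq_trans; apply.
all: by move=> /andP[/IHs-> /IHt->].
Qed.

Lemma wf_mono n m f : n <= m -> wf_qfree n f -> wf_qfree m f.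
Proof.
move=> nm; elim: f => //= [s t|s t|g IHg h IHh|g IHg h IHh].
1,2: by move=> /andP[/(wf_term_mono nm)-> /(wf_term_mono nm)->].
all: by move=> /andP[/IHg-> /IHh->].
Qed.

Lemma eval_ext n a b t : wf_term n t ->
  (forall i, i < n -> nth 0%R a i = nth 0%R b i) -> eval_term a t = eval_term b t.
Proof.
move=> + ab; elim: t => //= [s IHs t IHt|s IHs t IHt|s IHs t IHt].
all: by move=> /andP[/IHs-> /IHt->].
Qed.

Lemma holds_ext n a b f : wf_qfree n f ->
  (forall i, i < n -> nth 0%R a i = nth 0%R b i) ->
  holds_qfree a f = holds_qfree b f.
Proof.
move=> + ab; elim: f => //= [s t|s t|g IHg|g IHg h IHh|g IHg h IHh].
1,2: by move=> /andP[/(eval_ext) /(_ ab)-> /(eval_ext)/(_ ab)->].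
  by move/IHg->.
all: by move=> /andP[/IHg-> /IHh->].
Qed.

Fixpoint nquant (f : prenex) : nat := if f is PEx g then (nquant g).+1 else 0.
Fixpoint matrix_of (f : prenex) : qfree :=
  match f with PMatrix g => g | PEx g => matrix_of g end.

Lemma holdsP a f : holds a f <->
  exists2 z, size z = nquant f & holds_qfree (a ++ z) (matrix_of f).
Proof.
elim: f a => [g|g IH] a /=.
  split=> [h|[[|z s] //= _]]; last by rewrite cats0.
  by exists [::]; rewrite ?cats0.
split=> [[x /IH[z sz h]]|[[|x z] //= [sz] h]].
  by exists (x :: z); rewrite /= ?sz // -cat_rcons.
by exists x; apply/IH; exists z; rewrite // cat_rcons.
Qed.

Lemma wf_matrix_of n f : wf_prenex n f -> wf_qfree (n + nquant f) (matrix_of f).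
Proof.
by elim: f n => [g|g IH] n /=; [rewrite addn0 | rewrite addnS -addSn => /IH].
Qed.

Definition qtrue := QEq (TConst 0) (TConst 0).

(** The least [v] with [b < 2 ^ v], or 0 for negative [b], which arises from an empty domain. The
    test in [nbitsP] is that of the loop [nbits_body]. *)
Definition nbits (b : int) : nat := if (0 <= b)%R then up_log 2 (absz b).+1 else 0.

Lemma nbitsP (b : int) v : ((2 ^ v)%:Z <= b)%R = (v < nbits b).
Proof.
rewrite /nbits; case: ifP => b0; last by apply/negbTE; lia.
rewrite -{1}(gez0_abs b0) lez_nat; apply/idP/idP => h.
  rewrite ltnNge; apply/negP => h2.
  have := up_logP (absz b).+1 (isT : 1 < 2); rewrite ltnNge => /negP; apply.
  by apply: leq_trans h; rewrite leq_exp2l.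
by rewrite leqNgt; apply: contraL h => /(up_log_min (isT : 1 < 2)); rewrite leqNgt.
Qed.

(** Horner form of a mixed radix number: the digit of a variable is its offset from the lower end of
    its domain, and the radix is rounded up to a power of two. *)
Fixpoint pack_term (i : nat) (ds : seq (int * int)) : term :=
  if ds is d :: ds' then
    TAdd (TSub (TVar i) (TConst d.1))
      (TMul (TConst (2 ^ nbits (d.2 - d.1)%R)%:Z) (pack_term i.+1 ds'))
  else TConst 0.

Fixpoint dom_qfree (i : nat) (ds : seq (int * int)) : qfree :=
  if ds is d :: ds' then
    QAnd (QLe (TConst d.1) (TVar i))
      (QAnd (QLe (TVar i) (TConst d.2)) (dom_qfree i.+1 ds'))
  else qtrue.

Fixpoint width (ds : seq (int * int)) : nat :=
  if ds is d :: ds' then nbits (d.2 - d.1)%R + width ds' else 0.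

Fixpoint pack (a : seq int) (ds : seq (int * int)) : nat :=
  match a, ds with
  | x :: a', d :: ds' => absz (x - d.1)%R + 2 ^ nbits (d.2 - d.1)%R * pack a' ds'
  | _, _ => 0
  end.

Lemma nbits_dom (x : int) (d : int * int) : (d.1 <= x <= d.2)%R ->
  absz (x - d.1)%R < 2 ^ nbits (d.2 - d.1)%R.
Proof.
move=> h; have := nbitsP (d.2 - d.1)%R (nbits (d.2 - d.1)%R); rewrite ltnn.
by move: (2 ^ _) => y; lia.
Qed.

Lemma pack_lt a ds : in_doms a ds -> pack a ds < 2 ^ width ds.
Proof.
elim: ds a => [|d ds IH] [|x a] //= /andP[/nbits_dom xd /IH ad].
rewrite expnD; move: xd ad; move: (absz _) (2 ^ _) (2 ^ _) (pack _ _) => u v w y.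
by nia.
Qed.

(** The residue modulo the first radix is the first digit; cancelling it leaves the packed tails. *)
Lemma pack_inj a b ds : in_doms a ds -> in_doms b ds ->
  pack a ds = pack b ds -> a = b.
Proof.
elim: ds a b => [|d ds IH] [|x a] [|y b] //= /andP[xd ad] /andP[yd bd].
have := nbits_dom xd; have := nbits_dom yd; have := IH _ _ ad bd.
move: (2 ^ _) (pack _ _) (pack _ _) => P u v uv yP xP E.
have P0 : 0 < P by case: P yP {xP E}.
have := congr1 (modn^~ P) E; rewrite !(addnC (absz _)) ![P * _]mulnC !modnMDl.
rewrite !modn_small // => xy; move: E; rewrite xy => /addnI/eqP.
rewrite eqn_pmul2l // => /eqP/uv->; congr (_ :: _).
by move: xd yd xy; lia.
Qed.

Fixpoint slice (a : seq int) (i n : nat) : seq int :=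
  if n is n'.+1 then nth 0%R a i :: slice a i.+1 n' else [::].

Lemma nth_slice a i n j : j < n -> nth 0%R (slice a i n) j = nth 0%R a (i + j).
Proof.
by elim: n i j => [|n IH] i [|j] //=; rewrite ?addn0 // ltnS addnS -addSn => /IH.
Qed.

Lemma size_slice a i n : size (slice a i n) = n.
Proof. by elim: n i => //= n IH i; rewrite IH. Qed.

Lemma holds_dom a i ds :
  holds_qfree a (dom_qfree i ds) = in_doms (slice a i (size ds)) ds.
Proof. by elim: ds i => //= d ds IH i; rewrite IH andbA. Qed.

Lemma eval_pack a i ds : in_doms (slice a i (size ds)) ds ->
  eval_term a (pack_term i ds) = Posz (pack (slice a i (size ds)) ds).
Proof.
elim: ds i => //= d ds IH i /andP[xd /IH->].
by rewrite PoszD PoszM gez0_abs // subr_ge0; case/andP: xd.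
Qed.

Lemma wf_dom i ds : wf_qfree (i + size ds) (dom_qfree i ds).
Proof. by elim: ds i => //= d ds IH i; rewrite addnS -addSn IH ltn_addr. Qed.

Lemma wf_pack i ds : wf_term (i + size ds) (pack_term i ds).
Proof. by elim: ds i => //= d ds IH i; rewrite addnS -addSn IH ltn_addr. Qed.

(** * Oracle queries *)

(** Each copy occupies [B] variables, the last of which carries its value. The first [t] copies
    satisfy [g], and each has a smaller value than the next one; one more copy, not constrained by
    [g], only bounds the last of these values from above. *)
Fixpoint chain (t o : nat) (g : qfree) (B : nat) : qfree :=
  if t is t'.+1 then
    QAnd (shift_qfree o g)
      (QAnd (QNot (QLe (TVar (o + B + B.-1)) (TVar (o + B.-1))))
            (chain t' (o + B) g B))
  else qtrue.

(** All variables are existential, so the formula has no domains and its only possible model is the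
    empty tuple. *)
Definition query (t : nat) (g : qfree) (B : nat) : formula :=
  Formula [::] (iter (t.+1 * B) PEx (PMatrix (chain t 0 g B))).

Lemma nquant_iter n g : nquant (iter n PEx (PMatrix g)) = n.
Proof. by elim: n => //= n ->. Qed.

Lemma matrix_of_iter n g : matrix_of (iter n PEx (PMatrix g)) = g.
Proof. by elim: n. Qed.

Lemma wf_iter k n g : wf_prenex k (iter n PEx (PMatrix g)) = wf_qfree (k + n) g.
Proof. by elim: n k => [|n IH] k /=; rewrite ?addn0 // addnS -addSn IH. Qed.

Lemma wf_chain t o g B : 0 < B -> wf_qfree B g ->
  wf_qfree (o + t.+1 * B) (chain t o g B).
Proof.
move=> B0 wfg; elim: t o => [|t IH] o //=.
have := IH (o + B); rewrite -addnA -mulSn => ->; rewrite andbT.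
apply/andP; split; first by apply: wf_mono (wf_shift o wfg); rewrite !mulSn; lia.
by rewrite !mulSn; apply/andP; split; lia.
Qed.

Lemma holds_chain a t o g B : holds_qfree a (chain t o g B) <->
  forall i, i < t -> holds_qfree (drop (o + i * B) a) g /\
    (nth 0%R a (o + i * B + B.-1) < nth 0%R a (o + i.+1 * B + B.-1))%R.
Proof.
elim: t o => [|t IH] o //=; rewrite holds_shift -ltNge; split.
  case/and3P=> h1 h2 /IH h [|i] it; first by rewrite mul0n mul1n addn0.
  by have := h i it; rewrite -!addnA -!mulSn.
move=> h; apply/and3P; split.
- by have := h 0 isT; rewrite mul0n addn0 => -[].
- by have := h 0 isT; rewrite mul0n mul1n addn0 => -[].
by apply/IH => i it; have := h i.+1 it; rewrite -!addnA -!mulSn.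
Qed.

Lemma sat_query t g B : 0 < B -> wf_qfree B g ->
  sat_oracle (enc_formula (query t g B)) <->
  exists a, holds_qfree a (chain t 0 g B).
Proof.
move=> B0 wfg; have wfc := wf_chain t 0 B0 wfg; rewrite add0n in wfc.
split=> [/asboolP[phi [/enc_formula_inj<- _ [a [a0]]]]|[a h]].
  by case/holdsP=> z _; rewrite matrix_of_iter => h; exists (a ++ z).
apply/asboolP; exists (query t g B); split=> //.
  by rewrite /wf_formula /= wf_iter.
exists [::]; split=> //; apply/holdsP; exists (slice a 0 (t.+1 * B)).
  by rewrite size_slice nquant_iter.
rewrite matrix_of_iter cat0s (@holds_ext _ _ a _ wfc) // => i it.
by rewrite nth_slice.
Qed.

(* The distinguished variable [B.-1] of the copies takes the values in [s];
   sorting [s] makes it increasing along the chain. *)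
Lemma sat_query_count t g B (s : seq nat) : 0 < B -> wf_qfree B g -> uniq s ->
  (forall Y : int, (exists2 a, nth 0%R a B.-1 = Y & holds_qfree a g) <->
     exists2 X, Y = Posz X & X \in s) ->
  sat_oracle (enc_formula (query t g B)) = (t <= size s).
Proof.
move=> B0 wfg us gP; apply/idP/idP => [/(sat_query t B0 wfg)[a /holds_chain h]|ts].
  pose y i := nth 0%R a (i * B + B.-1).
  have yP i : i < t -> exists2 X, y i = Posz X & X \in s.
    move=> it; apply/gP; exists (drop (i * B) a); first by rewrite nth_drop.
    by have [] := h i it.
  (* The values of the first [t] copies increase strictly, hence are [t] distinct elements of
     [s]. *)
  pose xs := mkseq (fun i => absz (y i)) t.
  have sub : {subset xs <= s}.
    by move=> x /mapP[i]; rewrite mem_iota => /andP[_ it] ->; have [X -> ] := yP i it.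
  rewrite -(size_mkseq (fun i => absz (y i)) t); apply: uniq_leq_size sub.
  apply: (@sorted_uniq _ ltn ltn_trans ltnn); apply/(sortedP 0) => i.
  rewrite size_mkseq => it; rewrite !nth_mkseq ?(ltnW it) //.
  have [X yX _] := yP i (ltnW it); have [X' yX' _] := yP i.+1 it.
  by have [_] := h i (ltnW it); rewrite !add0n -/(y i) -/(y i.+1) yX yX' ltz_nat.
pose xs := sort leq s.
have xs_sorted : sorted ltn xs.
  by rewrite ltn_sorted_uniq_leq sort_uniq us sort_sorted //; exact: leq_total.
have size_xs : size xs = size s by rewrite size_sort.
(* A value above all of [s], for the additional copy at the end of the chain. *)
pose m := (\max_(x <- s) x).+1.
pose y i : nat := if i < t then nth 0 xs i else m.
have yP i : exists a, nth 0%R a B.-1 = Posz (y i) /\ (i < t -> holds_qfree a g).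
  rewrite /y; case: (ltnP i t) => [it|_]; last first.
    exists (ncons B.-1 0%R [:: Posz m]); split => //.
    by rewrite nth_ncons ltnn subnn.
  have [|a aY ah] := (gP (Posz (nth 0 xs i))).2; last by exists a.
  by exists (nth 0 xs i) => //; rewrite -(mem_sort leq) mem_nth // size_xs (leq_trans it).
have [f fP] := boolp.choice yP.
pose a := mkseq (fun j => nth 0%R (f (j %/ B)) (j %% B)) (t.+1 * B).
have aE i j : i <= t -> j < B -> nth 0%R a (i * B + j) = nth 0%R (f i) j.
  move=> it jB; rewrite nth_mkseq.
    by rewrite divnMDl // divn_small // addn0 modnMDl modn_small.
  by rewrite mulSn addnC -addSn leq_add // leq_mul.
apply/sat_query => //; exists a; apply/holds_chain => i it; rewrite !add0n.
have Bp : B.-1 < B by rewrite prednK.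
split.
  rewrite (@holds_ext _ _ (f i) _ wfg) => [|j jB]; first exact: (fP i).2.
  by rewrite nth_drop aE // ltnW.
rewrite !aE ?(ltnW it) // (fP i).1 (fP i.+1).1 ltz_nat /y it.
have it' : i < size xs by rewrite size_xs (leq_trans it).
case: ifP => it2.
  have /(sortedP 0)/(_ i) := xs_sorted; apply.
  by rewrite size_xs (leq_trans it2).
rewrite ltnS; apply: (@leq_bigmax_seq _ _ xpredT id) => //.
by rewrite -(mem_sort leq) mem_nth.
Qed.

(** Terms have no remainder operation, so the hash value is written [a y + b - P z] with an
    existentially quantified quotient [z]. *)
Definition hash_term (P a b : nat) (z y : nat) : term :=
  TSub (TAdd (TMul (TConst (Posz a)) (TVar y)) (TConst (Posz b)))
       (TMul (TConst (Posz P)) (TVar z)).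

(* With [n] the number of variables of [phi], variable [n] is the quotient of the
   hash by its modulus and variable [n.+1] the packed value of the model. *)
Definition base_qfree (phi : formula) (P a b : nat) : qfree :=
  let n := size (fdoms phi) + nquant (fbody phi) in
  QAnd (dom_qfree 0 (fdoms phi))
    (QAnd (QEq (TVar n.+1) (pack_term 0 (fdoms phi)))
      (QAnd (matrix_of (fbody phi))
        (QLe (TConst 0) (hash_term P a b n n.+1)))).

Definition cell_qfree (phi : formula) (P a b M : nat) : qfree :=
  let n := size (fdoms phi) + nquant (fbody phi) in
  QAnd (base_qfree phi P a b)
    (QNot (QLe (TConst (Posz P)) (TMul (TConst (Posz M)) (hash_term P a b n n.+1)))).

Definition copy_size (phi : formula) : nat :=
  (size (fdoms phi) + nquant (fbody phi)).+2.

Definition packed_models (phi : formula) : seq nat :=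
  [seq pack a (fdoms phi) | a <- fset_set (models phi)].

Lemma mem_models phi a : (a \in fset_set (models phi)) <->
  in_doms a (fdoms phi) /\ holds a (fbody phi).
Proof.
rewrite in_fset_set; last exact: finite_models.
by split=> [/classical_sets.set_mem //|h]; exact/classical_sets.mem_set.
Qed.

Lemma size_packed_models phi : size (packed_models phi) = model_count phi.
Proof. by rewrite size_map. Qed.

Lemma packed_models_uniq phi : uniq (packed_models phi).
Proof.
rewrite map_inj_in_uniq ?fset_uniq // => a b /mem_models[ad _] /mem_models[bd _].
exact: pack_inj ad bd.
Qed.

Lemma packed_models_lt phi X : X \in packed_models phi -> X < 2 ^ width (fdoms phi).
Proof. by case/mapP=> a /mem_models[ad _] ->; exact: pack_lt. Qed.

Lemma wf_cell phi P a b M : wf_formula phi ->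
  wf_qfree (copy_size phi) (cell_qfree phi P a b M).
Proof.
move=> /wf_matrix_of wfm; rewrite /copy_size /=.
set n := _ + _; have n2 : n <= n.+2 by rewrite ltnW.
have kn : 0 + size (fdoms phi) <= n.+2 by rewrite (leq_trans _ n2) // leq_addr.
rewrite (wf_mono kn (wf_dom 0 _)) (wf_term_mono kn (wf_pack 0 _)) (wf_mono n2 wfm).
by rewrite ltnSn (leqnSn n.+1 : n < n.+2).
Qed.

(** As [0 < M], the two inequalities place the value between 0 and [P - 1], which forces it to be
    the remainder of [a X + b]. *)
Lemma in_cellP (P M a b X : nat) : 0 < P -> 0 < M ->
  in_cell P M a b X <-> exists z : int,
   (0 <= a%:Z * X%:Z + b%:Z - P%:Z * z /\ (M%:Z * (a%:Z * X%:Z + b%:Z - P%:Z * z) < P%:Z))%R.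
Proof.
move=> P0 M0; rewrite /in_cell; set c := a * X + b.
have -> : (a%:Z * X%:Z + b%:Z)%R = Posz c by rewrite PoszD PoszM.
split=> [h|[z [z0]]].
  exists (Posz (c %/ P)); have := divn_eq c P; move: h; nia.
set V := (_ - _)%R in z0 *.
have VE : V = Posz (absz V) by rewrite gez0_abs.
rewrite {1}VE => h.
have hV : absz V * M < P by move: h; rewrite -PoszM ltz_nat mulnC.
suff -> : c %% P = absz V by [].
have VP : absz V < P by apply: leq_ltn_trans hV; rewrite leq_pmulr.
have cE : (c%:Z = z * P%:Z + (absz V)%:Z)%R by rewrite -VE /V; ring.
have : (Posz c %% Posz P)%Z = Posz (absz V).
  by rewrite cE modzMDl modz_small //= ltz_nat VP.
by rewrite modz_nat => -[].
Qed.

Lemma slice_prefix a c : slice (a ++ c) 0 (size a) = a.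
Proof.
apply: (@eq_from_nth _ 0%R) => [|i]; rewrite size_slice // => ia.
by rewrite nth_slice // nth_cat ia.
Qed.

(** The chain compares only packed values, so a model with several witnesses for its quantifiers is
    counted once; injectivity of the packing keeps different models apart. *)
Lemma sat_query_cell phi P a b M t : wf_formula phi -> 0 < P -> 0 < M ->
  sat_oracle (enc_formula (query t (cell_qfree phi P a b M) (copy_size phi))) =
  (t <= count (in_cell P M a b) (packed_models phi)).
Proof.
move=> wfp P0 M0; rewrite -size_filter.
apply: sat_query_count (wf_cell P a b M wfp) _ _ => //.
  by rewrite filter_uniq // packed_models_uniq.
have wfm := wf_matrix_of wfp; rewrite /copy_size /=.
move=> Y; split.
  case=> c <- /=; set n := _ + _ in wfm *; pose k := size (fdoms phi).
  case/andP=> /and4P[]; rewrite holds_dom => cd /eqP yE hm V0; rewrite -ltNge => VM.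
  rewrite (eval_pack cd) in yE.
  exists (pack (slice c 0 k) (fdoms phi)) => //.
  rewrite mem_filter; apply/andP; split.
    by apply/in_cellP => //; exists (nth 0%R c n); rewrite -yE.
  apply/mapP; exists (slice c 0 k) => //; apply/mem_models; split=> //.
  apply/holdsP; exists (slice c k (nquant (fbody phi))); first by rewrite size_slice.
  rewrite (@holds_ext _ _ c _ wfm) // => i; rewrite nth_cat size_slice.
  have [ik|ki] := ltnP i k; first by rewrite nth_slice.
  by move=> ikn; rewrite nth_slice ?subnKC // ltn_subLR.
case=> X ->; rewrite mem_filter => /andP[/in_cellP-/(_ P0 M0)[z [V0 VM]]].
case/mapP=> a0 /mem_models[ad /holdsP[zs sz hm]] XE.
have sa : size a0 = size (fdoms phi) by move: ad; rewrite /in_doms all2E => /andP[/eqP].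
(* The variables of a copy in order: model, quantifier witnesses, hash quotient, packed value. *)
pose c := (a0 ++ zs) ++ [:: z; Posz X].
have sc : size (a0 ++ zs) = size (fdoms phi) + nquant (fbody phi).
  by rewrite size_cat sa sz.
have cy : nth 0%R c (size (fdoms phi) + nquant (fbody phi)).+1 = Posz X.
  by rewrite -sc nth_cat ltnNge leqnSn subSnn.
have cz : nth 0%R c (size (fdoms phi) + nquant (fbody phi)) = z.
  by rewrite -sc nth_cat ltnn subnn.
have cs : slice c 0 (size (fdoms phi)) = a0.
  by rewrite -sa /c -catA slice_prefix.
exists c => //=; rewrite cy cz holds_dom cs ad /= eval_pack cs // XE eqxx /=.
rewrite -XE V0 -ltNge VM andbT andbT.
rewrite (@holds_ext _ _ (a0 ++ zs) _ wfm) // => i ik.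
by rewrite nth_cat sc ik.
Qed.

(** * The program *)

(** Functions of several arguments take nested pairs; the digits of an accessor spell the path, 1
    for [EFst] and 2 for [ESnd]. *)
Definition arg1 := EFst (EVar 0).
Definition arg2 := ESnd (EVar 0).
Definition arg21 := EFst arg2.
Definition arg22 := ESnd arg2.
Definition arg221 := EFst arg22.
Definition arg222 := ESnd arg22.

Definition etag (k : nat) (e : expr) : expr := EPair (ELit k) e.
Definition epair2 (k : nat) (e1 e2 : expr) : expr := etag k (EPair e1 e2).

(* Calls refer to positions in the list [counter] below: 1 [sh_body], 2 [nbits_body],
   3 [pack_body], 4 [strip_body], 5 [rnd_body], 6 [pow2_body], 7 [chain_body],
   8 [wrap_body], 9 [mul_body], 10 [cnt_body], 11 [level_body], 12 [ceil_body]. *)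

(* Argument [(o, v)]. *)
Definition sh_body : expr :=
  EIf (EIsPair arg2)
    (EIf (EIsPair (ESnd arg2))
       (EPair (ECall 1 (EPair arg1 (EFst arg2))) (ECall 1 (EPair arg1 (ESnd arg2))))
       (EIf (EFst arg2) arg2 (EPair (EFst arg2) (EAdd (ESnd arg2) arg1))))
    arg2.

(* Argument [(b, (2 ^ v, v))]. *)
Definition nbits_body : expr :=
  EIf (ELeq arg21 arg1)
    (ECall 2 (EPair arg1 (EPair (EAdd arg21 arg21) (EAdd arg22 (ELit 1)))))
    arg2.

(* Argument [(i, ds)]; result [(term, (constraints, (width, i + size ds)))]. *)
Definition pack_body : expr :=
  EIf (EIsPair arg2)
    (ELet (ECall 2 (EPair (ESub (ESnd arg21) (EFst arg21)) (EPair (ELit 1) (ELit 0))))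
    (ELet (ECall 3 (EPair (EAdd (EFst (EVar 1)) (ELit 1)) (ESnd (ESnd (EVar 1)))))
      (let x := etag 0 (EFst (EVar 2)) in
       let lo := etag 1 (EFst (EFst (ESnd (EVar 2)))) in
       let hi := etag 1 (ESnd (EFst (ESnd (EVar 2)))) in
       let pw := etag 1 (EFst (EVar 1)) in
       EPair
         (epair2 2 (epair2 3 x lo) (epair2 4 pw (EFst (EVar 0))))
         (EPair (epair2 3 (epair2 1 lo x) (epair2 3 (epair2 1 x hi) (EFst (ESnd (EVar 0)))))
            (EPair (EAdd (ESnd (EVar 1)) (EFst (ESnd (ESnd (EVar 0)))))
                   (ESnd (ESnd (ESnd (EVar 0)))))))))
    (EPair (etag 1 (ELit 0))
       (EPair (epair2 0 (etag 1 (ELit 0)) (etag 1 (ELit 0)))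
          (EPair (ELit 0) arg1))).

(* Argument [(v, n)]. *)
Definition strip_body : expr :=
  EIf (EFst arg1)
    (ECall 4 (EPair (ESnd arg1) (EAdd arg2 (ELit 1))))
    (EPair (ESnd arg1) arg2).

Definition rnd_body : expr :=
  EIf (ELeq (ELit 1) (EVar 0))
    (ELet EFlip (ELet (ECall 5 (ESub (EVar 1) (ELit 1)))
       (EAdd (EVar 1) (EAdd (EVar 0) (EVar 0)))))
    (ELit 0).

Definition pow2_body : expr :=
  EIf (ELeq (ELit 1) (EVar 0))
    (ELet (ECall 6 (ESub (EVar 0) (ELit 1))) (EAdd (EVar 0) (EVar 0)))
    (ELit 1).

(* Argument [(t, (o, (g, B)))]. *)
Definition chain_body : expr :=
  EIf (ELeq (ELit 1) arg1)
    (epair2 3 (ECall 1 (EPair arg21 arg221))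
       (epair2 3
          (etag 2 (epair2 1
             (etag 0 (ESub (EAdd (EAdd arg21 arg222) arg222) (ELit 1)))
             (etag 0 (ESub (EAdd arg21 arg222) (ELit 1)))))
          (ECall 7 (EPair (ESub arg1 (ELit 1)) (EPair (EAdd arg21 arg222) arg22)))))
    (epair2 0 (etag 1 (ELit 0)) (etag 1 (ELit 0))).

(* Argument [(n, v)]. *)
Definition wrap_body : expr :=
  EIf (ELeq (ELit 1) arg1)
    (ECall 8 (EPair (ESub arg1 (ELit 1)) (etag 1 arg2)))
    arg2.

(** Repeated addition: in every call the first factor is polynomially bounded, while the second may
    be as large as [2 ^ m]. *)
Definition mul_body : expr :=
  EIf (ELeq (ELit 1) arg1)
    (EAdd arg2 (ECall 9 (EPair (ESub arg1 (ELit 1)) arg2)))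
    (ELit 0).

(* Argument [(t, (g, B))]. *)
Definition cnt_body : expr :=
  EIf (ELeq (ELit 1) arg1)
    (EIf (EQuery (EPair (ELit 0)
            (ECall 8 (EPair (ECall 9 (EPair (EAdd arg1 (ELit 1)) arg22))
               (etag 0 (ECall 7 (EPair arg1 (EPair (ELit 0) arg2))))))))
       arg1
       (ECall 10 (EPair (ESub arg1 (ELit 1)) arg2)))
    (ELit 0).

(* Argument [(fuel, (M, (thr, (base, (V, (P, B))))))]. *)
Definition level_body : expr :=
  ELet (ECall 10 (EPair arg221
      (EPair (epair2 3 (EFst arg222)
                (etag 2 (epair2 1 (etag 1 (EFst (ESnd (ESnd arg222))))
                                  (epair2 4 (etag 1 arg21) (EFst (ESnd arg222))))))
             (ESnd (ESnd (ESnd arg222))))))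
    (let arg := EVar 1 in
     EIf (ELeq (ELit 1) (EFst arg))
       (EIf (ELeq (EFst (ESnd (ESnd arg))) (EVar 0))
          (ECall 11 (EPair (ESub (EFst arg) (ELit 1))
             (EPair (EAdd (EFst (ESnd arg)) (EFst (ESnd arg))) (ESnd (ESnd arg)))))
          (ECall 9 (EPair (EVar 0) (EFst (ESnd arg)))))
       (ECall 9 (EPair (EVar 0) (EFst (ESnd arg))))).

(* Argument [(c, (num, (den, j)))]. *)
Definition ceil_body : expr :=
  EIf (ELeq arg221 arg1) arg222
    (ECall 12 (EPair (EAdd arg1 arg21) (EPair arg21 (EPair arg221 (EAdd arg222 (ELit 1)))))).

(** With [L = 2 w + 1], [L] tosses are read for each of [a] and [b]; [e] is the rounded-up [1 / eps]
    plus one. The result is a fraction with denominator 1. *)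
Definition main_body : expr :=
  ELet (ECall 3 (EPair (ELit 0) (EFst (EFst (EVar 0)))))
  (ELet (ECall 4 (EPair (ESnd (EFst (EVar 1))) (ESnd (ESnd (ESnd (EVar 0))))))
  (ELet (EAdd (EAdd (EFst (ESnd (ESnd (EVar 1)))) (EFst (ESnd (ESnd (EVar 1))))) (ELit 1))
  (ELet (ECall 5 (EVar 0))
  (ELet (ECall 5 (EVar 1))
  (ELet (ECall 6 (EVar 2))
  (ELet (let eps := ESnd (EVar 6) in
     EAdd (ECall 12 (EPair (EFst eps) (EPair (EFst eps) (EPair (ESnd eps) (ELit 1))))) (ELit 1))
  (ELet (ECall 9 (EPair (ELit (Posz 32)) (ECall 9 (EPair (EVar 0) (EVar 0)))))
  (* 0: thr, 1: e, 2: P, 3: b, 4: a, 5: L, 6: (matrix, n), 7: packing, 8: input *)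
  (ELet (let z := etag 0 (ESnd (EVar 6)) in
     let y := etag 0 (EAdd (ESnd (EVar 6)) (ELit 1)) in
     epair2 3 (epair2 2 (epair2 4 (etag 1 (EVar 4)) y) (etag 1 (EVar 3)))
              (epair2 4 (etag 1 (EVar 2)) z))
  (ELet (let y := etag 0 (EAdd (ESnd (EVar 7)) (ELit 1)) in
     epair2 3 (EFst (ESnd (EVar 8)))
       (epair2 3 (epair2 0 y (EFst (EVar 8)))
          (epair2 3 (EFst (EVar 7)) (epair2 1 (etag 1 (ELit 0)) (EVar 0)))))
  (EPair
    (ECall 11 (EPair (EFst (ESnd (ESnd (EVar 9))))
       (EPair (ELit 1) (EPair (EVar 2) (EPair (EVar 0) (EPair (EVar 1) (EPair (EVar 4)
          (EAdd (ESnd (EVar 8)) (ELit 2)))))))))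
    (ELit 1))))))))))).

Definition counter : program :=
  [:: main_body; sh_body; nbits_body; pack_body; strip_body; rnd_body; pow2_body;
      chain_body; wrap_body; mul_body; cnt_body; level_body; ceil_body].

(** * Evaluation with an upper bound on the steps *)

Definition evb (env : seq Defs.val) (e : expr) (r : seq bool) (v : Defs.val) (T : nat)
    (r' : seq bool) : Prop :=
  exists2 t, ev sat_oracle counter env e r v t r' & t <= T.

Lemma evb_weaken env e r v v' T T' r' :
  evb env e r v T r' -> v = v' -> T <= T' -> evb env e r v' T' r'.
Proof. by move=> [t h tT] <- TT'; exists t => //; exact: leq_trans TT'. Qed.

Lemma evb_var env i r : evb env (EVar i) r (nth (VInt 0) env i) 1 r.
Proof. by exists 1 => //; constructor. Qed.

Lemma evb_lit env c r : evb env (ELit c) r (VInt c) 1 r.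
Proof. by exists 1 => //; constructor. Qed.

Lemma evb_add env e1 e2 r r1 r2 v1 v2 T1 T2 :
  evb env e1 r v1 T1 r1 -> evb env e2 r1 v2 T2 r2 ->
  evb env (EAdd e1 e2) r (VInt (vint v1 + vint v2)%R) (T1 + T2).+1 r2.
Proof.
move=> [t1 h1 l1] [t2 h2 l2]; exists (t1 + t2).+1; last by rewrite ltnS leq_add.
by econstructor; eauto.
Qed.

Lemma evb_sub env e1 e2 r r1 r2 v1 v2 T1 T2 :
  evb env e1 r v1 T1 r1 -> evb env e2 r1 v2 T2 r2 ->
  evb env (ESub e1 e2) r (VInt (vint v1 - vint v2)%R) (T1 + T2).+1 r2.
Proof.
move=> [t1 h1 l1] [t2 h2 l2]; exists (t1 + t2).+1; last by rewrite ltnS leq_add.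
by econstructor; eauto.
Qed.

Lemma evb_leq env e1 e2 r r1 r2 v1 v2 T1 T2 :
  evb env e1 r v1 T1 r1 -> evb env e2 r1 v2 T2 r2 ->
  evb env (ELeq e1 e2) r (vbool (vint v1 <= vint v2)%R) (T1 + T2).+1 r2.
Proof.
move=> [t1 h1 l1] [t2 h2 l2]; exists (t1 + t2).+1; last by rewrite ltnS leq_add.
by econstructor; eauto.
Qed.

Lemma evb_pair env e1 e2 r r1 r2 v1 v2 T1 T2 :
  evb env e1 r v1 T1 r1 -> evb env e2 r1 v2 T2 r2 ->
  evb env (EPair e1 e2) r (VPair v1 v2) (T1 + T2).+1 r2.
Proof.
move=> [t1 h1 l1] [t2 h2 l2]; exists (t1 + t2).+1; last by rewrite ltnS leq_add.
by econstructor; eauto.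
Qed.

Lemma evb_fst env e r r1 v T :
  evb env e r v T r1 -> evb env (EFst e) r (vfst v) T.+1 r1.
Proof. by move=> [t h l]; exists t.+1 => //; constructor. Qed.

Lemma evb_snd env e r r1 v T :
  evb env e r v T r1 -> evb env (ESnd e) r (vsnd v) T.+1 r1.
Proof. by move=> [t h l]; exists t.+1 => //; constructor. Qed.

Lemma evb_ispair env e r r1 v T :
  evb env e r v T r1 -> evb env (EIsPair e) r (vbool (vispair v)) T.+1 r1.
Proof. by move=> [t h l]; exists t.+1 => //; constructor. Qed.

Lemma evb_if (b : bool) env e e1 e2 r r1 r2 v w T1 T2 :
  evb env e r v T1 r1 -> vtrue v = b ->
  evb env (if b then e1 else e2) r1 w T2 r2 ->
  evb env (EIf e e1 e2) r w (T1 + T2).+1 r2.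
Proof.
move=> [t1 h1 l1] <- [t2 h2 l2]; exists (t1 + t2).+1; last by rewrite ltnS leq_add.
by econstructor; eauto.
Qed.

Lemma evb_let env e1 e2 r r1 r2 v1 v2 T1 T2 :
  evb env e1 r v1 T1 r1 -> evb (v1 :: env) e2 r1 v2 T2 r2 ->
  evb env (ELet e1 e2) r v2 (T1 + T2).+1 r2.
Proof.
move=> [t1 h1 l1] [t2 h2 l2]; exists (t1 + t2).+1; last by rewrite ltnS leq_add.
by econstructor; eauto.
Qed.

Lemma evb_call env f e r r1 r2 v v' w T1 T2 :
  evb env e r v T1 r1 -> v = v' -> evb [:: v'] (body counter f) r1 w T2 r2 ->
  evb env (ECall f e) r w (T1 + T2).+1 r2.
Proof.
move=> [t1 h1 l1] <- [t2 h2 l2]; exists (t1 + t2).+1; last by rewrite ltnS leq_add.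
by econstructor; eauto.
Qed.

Lemma evb_flip env b r : evb env EFlip (b :: r) (vbool b) 1 r.
Proof. by exists 1 => //; constructor. Qed.

Lemma evb_query env e r r1 v T :
  evb env e r v T r1 ->
  evb env (EQuery e) r (vbool (sat_oracle v)) (T + vsize v).+1 r1.
Proof.
move=> [t h l]; exists (t + vsize v).+1; first by constructor.
by rewrite ltnS leq_add2r.
Qed.

(* The goals left by [evs] are, for a call, the argument value and the evaluation of
   the body and, for a conditional, the truth value and the selected branch. *)
Ltac evs :=
  lazymatch goal with |- evb _ ?e _ _ _ _ =>
    let e' := eval hnf in e in
    lazymatch e' with
    | EVar _ => eapply evb_var
    | ELit _ => eapply evb_lit
    | EAdd _ _ => eapply evb_add; [evs | evs]
    | ESub _ _ => eapply evb_sub; [evs | evs]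
    | ELeq _ _ => eapply evb_leq; [evs | evs]
    | EPair _ _ => eapply evb_pair; [evs | evs]
    | EFst _ => eapply evb_fst; evs
    | ESnd _ => eapply evb_snd; evs
    | EIsPair _ => eapply evb_ispair; evs
    | EQuery _ => eapply evb_query; evs
    | ELet _ _ => eapply evb_let; [evs | evs]
    | EFlip => eapply evb_flip
    | EIf _ _ _ => eapply evb_if; [evs | | ]
    | ECall _ _ => eapply evb_call; [evs | | ]
    | _ => idtac
    end
  end.

(* In encoded terms and quantifier-free formulas, a pair of two integers is either a
   variable (tag 0) or a constant (tag 1), so other nodes need not be told apart. *)
Fixpoint shift_val (o : nat) (v : Defs.val) : Defs.val :=
  match v with
  | VInt _ => v
  | VPair u w =>
      if vispair w then VPair (shift_val o u) (shift_val o w)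
      else if vtrue u then v else VPair u (VInt (vint w + Posz o)%R)
  end.

Lemma vsize_gt1 v : 1 < vsize v.
Proof. by elim: v => //= u hu w hw; lia. Qed.

Lemma ev_sh o v r :
  evb [:: VPair (VInt (Posz o)) v] (body counter 1) r (shift_val o v) (30 * vsize v) r.
Proof.
elim: v => [z|u IHu w IHw].
  by eapply evb_weaken; [evs; [reflexivity | evs] | | rewrite /=; lia].
have := vsize_gt1 u; have := vsize_gt1 w => w1 u1.
case pw: (vispair w).
  eapply evb_weaken; [evs; [reflexivity | evs] | | ].
  - by rewrite /= pw.
  - by evs; [reflexivity | exact: IHu | reflexivity | exact: IHw].
  - by rewrite /= pw.
  - by rewrite /=; lia.
case tu: (vtrue u).
  eapply evb_weaken; [evs; [reflexivity | evs] | | ].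
  - by rewrite /= pw.
  - by evs; [exact: tu | evs].
  - by rewrite /= pw tu.
  - by rewrite /=; lia.
eapply evb_weaken; [evs; [reflexivity | evs] | | ].
- by rewrite /= pw.
- by evs; [exact: tu | evs].
- by rewrite /= pw tu.
- by rewrite /=; lia.
Qed.

Lemma vtrue_leqS n : vtrue (vbool (1 <= Posz n.+1)%R) = true.
Proof. by []. Qed.

Lemma predz n : (Posz n.+1 - 1)%R = Posz n.
Proof. by rewrite -natz; lia. Qed.

Lemma ev_mul a b r :
  evb [:: VPair (VInt (Posz a)) (VInt (Posz b))] (body counter 9) r
    (VInt (Posz (a * b))) (20 * a + 10) r.
Proof.
elim: a => [|a IH]; first by eapply evb_weaken; [evs; [reflexivity | evs] | |].
eapply evb_weaken; [evs; [exact: vtrue_leqS | evs] | | ].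
- by rewrite /= predz.
- exact: IH.
- by rewrite /= mulSn PoszD.
- by lia.
Qed.

Lemma ev_pow2 n r :
  evb [:: VInt (Posz n)] (body counter 6) r (VInt (Posz (2 ^ n))) (20 * n + 10) r.
Proof.
elim: n => [|n IH]; first by eapply evb_weaken; [evs; [reflexivity | evs] | |].
eapply evb_weaken; [evs; [exact: vtrue_leqS | evs] | | ].
- by rewrite /= predz.
- exact: IH.
- by rewrite /= expnS mul2n -addnn PoszD.
- by lia.
Qed.

Lemma ev_rnd n r : n <= size r ->
  evb [:: VInt (Posz n)] (body counter 5) r (VInt (Posz (bits n r))) (20 * n + 10)
    (drop n r).
Proof.
elim: n r => [|n IH] r.
  by move=> _; rewrite drop0; eapply evb_weaken; [evs; [reflexivity | evs] | |].
case: r => // b r; rewrite ltnS => /IH {}IH.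
eapply evb_weaken; [evs; [exact: vtrue_leqS | evs] | | ].
- by rewrite /= predz.
- exact: IH.
- by rewrite /= -addnn !PoszD.
- by lia.
Qed.

(** The loop adds [num] until [den] is reached. Started with [c = num] and [j = 1] on the parts of a
    positive [eps], it returns [1 / eps] rounded up. *)
Lemma ev_ceil (c num den : int) (j n : nat) r :
  (forall i, i < n -> (c + num * Posz i < den)%R) -> (den <= c + num * Posz n)%R ->
  evb [:: VPair (VInt c) (VPair (VInt num) (VPair (VInt den) (VInt (Posz j))))]
    (body counter 12) r (VInt (Posz (j + n))) (40 * n + 20) r.
Proof.
elim: n c j => [|n IH] c j lt ge.
  have h : (den <= c)%R by move: ge; rewrite mulr0 addr0.
  eapply evb_weaken; [evs; [rewrite /= h; reflexivity | evs] | |] => //.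
  by rewrite addn0.
have h : (den <= c)%R = false.
  by have := lt 0 isT; rewrite mulr0 addr0 ltNge => /negbTE.
eapply evb_weaken; [evs; [rewrite /= h; reflexivity | evs] | | ].
- reflexivity.
- rewrite /= -[(Posz j + 1)%R]/(Posz (j + 1)); apply: IH => [i ni|].
    have := lt i.+1 ni; rewrite -[i.+1]add1n PoszD mulrDr mulr1 addrA //.
  by move: ge; rewrite -[n.+1]add1n PoszD mulrDr mulr1 addrA.
- by rewrite -addnA.
- by lia.
Qed.

Lemma ev_nbits (b : int) (v : nat) r : v <= nbits b ->
  evb [:: VPair (VInt b) (VPair (VInt (Posz (2 ^ v))) (VInt (Posz v)))]
    (body counter 2) r
    (VPair (VInt (Posz (2 ^ nbits b))) (VInt (Posz (nbits b))))
    (40 * (nbits b - v) + 20) r.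
Proof.
move=> vb; rewrite -{1 2}(subnKC vb).
move: (nbits b - v) (subnKC vb) => n; elim: n v {vb} => [|n IH] v E.
  have h : (Posz (2 ^ v) <= b)%R = false by rewrite nbitsP -E addn0 ltnn.
  by eapply evb_weaken; [evs; [rewrite /= h; reflexivity | evs] | rewrite /= addn0 |].
have h : (Posz (2 ^ v) <= b)%R by rewrite nbitsP -E addnS ltnS leq_addr.
eapply evb_weaken; [evs; [rewrite /= h; reflexivity | evs] | | ].
- reflexivity.
- rewrite /= -!PoszD addnn -mul2n -expnS addn1; apply: IH.
  by rewrite -E addnS.
- by rewrite addnS.
- by lia.
Qed.

Lemma ev_wrap n f r :
  evb [:: VPair (VInt (Posz n)) (enc_prenex f)] (body counter 8) r
    (enc_prenex (iter n PEx f)) (20 * n + 10) r.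
Proof.
elim: n f => [|n IH] f; first by eapply evb_weaken; [evs; [reflexivity | evs] | |].
eapply evb_weaken; [evs; [exact: vtrue_leqS | evs] | | ].
- by rewrite /= predz.
- exact: (IH (PEx f)).
- by rewrite -iterSr.
- by lia.
Qed.

Lemma ev_strip f n r :
  evb [:: VPair (enc_prenex f) (VInt (Posz n))] (body counter 4) r
    (VPair (enc_qfree (matrix_of f)) (VInt (Posz (n + nquant f))))
    (20 * nquant f + 20) r.
Proof.
elim: f n => [g|f IH] n.
  eapply evb_weaken; [evs; [reflexivity | evs] | |] => //.
  by rewrite /= addn0.
eapply evb_weaken; [evs; [reflexivity | evs] | | ].
- reflexivity.
- by rewrite /= -[(Posz n + 1)%R]/(Posz (n + 1)); exact: IH.
- by rewrite -addnA.
- by rewrite /=; lia.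
Qed.

Lemma vispair_enc_term t : vispair (enc_term t).
Proof. by case: t. Qed.

Lemma vispair_enc_qfree f : vispair (enc_qfree f).
Proof. by case: f. Qed.

Lemma shift_val_term o t : shift_val o (enc_term t) = enc_term (shift_term o t).
Proof.
by elim: t => //= [s IHs t IHt|s IHs t IHt|s IHs t IHt]; rewrite vispair_enc_term IHs IHt.
Qed.

Lemma shift_val_qfree o f : shift_val o (enc_qfree f) = enc_qfree (shift_qfree o f).
Proof.
elim: f => //= [s t|s t|g IHg|g IHg h IHh|g IHg h IHh].
1,2: by rewrite vispair_enc_term !shift_val_term.
  by rewrite vispair_enc_qfree IHg.
all: by rewrite vispair_enc_qfree IHg IHh.
Qed.

Lemma ev_pack i ds r :
  evb [:: VPair (VInt (Posz i)) (enc_doms ds)] (body counter 3) r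
    (VPair (enc_term (pack_term i ds)) (VPair (enc_qfree (dom_qfree i ds))
       (VPair (VInt (Posz (width ds))) (VInt (Posz (i + size ds))))))
    (300 * size ds + 40 * width ds + 50) r.
Proof.
elim: ds i => [|d ds IH] i.
  eapply evb_weaken; [evs; [reflexivity | evs] | |] => //.
  by rewrite /= addn0.
eapply evb_weaken; [evs; [reflexivity | evs] | | ].
- by rewrite /= -[1%R]/(Posz (2 ^ 0)).
- exact: ev_nbits.
- by rewrite /= -[(Posz i + 1)%R]/(Posz (i + 1)) addn1.
- exact: IH.
- by rewrite /= addnS PoszD.
- by rewrite /= subn0; lia.
Qed.

Lemma ev_chain t o g B r : 0 < B ->
  evb [:: VPair (VInt (Posz t)) (VPair (VInt (Posz o))
            (VPair (enc_qfree g) (VInt (Posz B))))] (body counter 7) r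
    (enc_qfree (chain t o g B)) (t * (30 * vsize (enc_qfree g) + 200) + 50) r.
Proof.
move=> B0; elim: t o => [|t IH] o.
  by eapply evb_weaken; [evs; [reflexivity | evs] | |].
eapply evb_weaken; [evs; [exact: vtrue_leqS | evs] | | ].
- reflexivity.
- exact: ev_sh.
- by rewrite /= predz.
- by rewrite -[(_ + _)%R]/(Posz (o + B)); exact: IH.
- rewrite /= shift_val_qfree.
  have -> : (Posz o + Posz B + Posz B - 1)%R = Posz (o + B + B.-1) by lia.
  by have -> : (Posz o + Posz B - 1)%R = Posz (o + B.-1) by lia.
- by rewrite mulSn /=; lia.
Qed.

(** * Size and cost of the queries *)

(** Bounds [T] shifted copies of a formula of size [G], with variable indices below [(T + 1) B],
    under a prefix of [(T + 1) B] quantifiers. *)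
Definition query_size (T G B : nat) : nat :=
  T * (G * (T.+1 * B).+1 + 2 * (T.+1 * B) + 60) + 3 * (T.+1 * B) + 40.

Definition query_cost (T G B : nat) : nat :=
  20 * T + 20 * (T.+1 * B) + T * (30 * G + 200) + query_size T G B + 300.

Lemma trunc_log_lt n k : 0 < k -> n < 2 ^ k -> trunc_log 2 n < k.
Proof.
move=> k0 nk; have [->|n0] := posnP n; first by rewrite trunc_log0.
by rewrite -(@ltn_exp2l 2) // (leq_ltn_trans (trunc_logP _ n0)).
Qed.

Lemma vsize_lt n k : n < 2 ^ k -> vsize (VInt (Posz n)) <= k + 2.
Proof.
move=> nk; rewrite /= addn2 !ltnS; have [k0|k0] := posnP k.
  by move: nk; rewrite k0 expn0 ltnS leqn0 => /eqP->; rewrite trunc_log0.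
by rewrite ltnW // trunc_log_lt.
Qed.

Lemma trunc_log_small : (trunc_log 2 0 = 0) * (trunc_log 2 1 = 0) *
  (trunc_log 2 2 = 1) * (trunc_log 2 3 = 1) * (trunc_log 2 4 = 2).
Proof. by []. Qed.

Lemma vsize_nat n : vsize (VInt (Posz n)) <= n + 2.
Proof. exact: vsize_lt (ltn_expl _ _). Qed.

Lemma vsize_add z o : vsize (VInt (z + Posz o)%R) <= vsize (VInt z) + o.
Proof.
rewrite /= !addSn !ltnS -ltnS; apply: trunc_log_lt => //.
have h1 : absz z < 2 ^ (trunc_log 2 (absz z)).+1 by rewrite trunc_log_ltn.
have h2 : o < 2 ^ o by rewrite ltn_expl.
have h3 : absz (z + Posz o)%R <= absz z + o by lia.
apply: leq_ltn_trans h3 _; rewrite -[(trunc_log _ _ + o).+1]addSn expnD.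
move: h1 h2; set x := 2 ^ _.+1; set y := 2 ^ o.
by move: x y => x y; nia.
Qed.

Lemma vsize_shift o v : vsize (shift_val o v) <= vsize v * o.+1.
Proof.
elim: v => [z|u IHu w IHw]; first by rewrite leq_pmulr.
rewrite /=; case: ifP => pw; first by rewrite /= mulSn mulnDl; move: IHu IHw; lia.
case: ifP => _; first by rewrite leq_pmulr.
case: w pw {IHw} => // z _; have := vsize_add z o; rewrite /=; nia.
Qed.

(** [O] bounds all variable indices; in the recursion [o] grows by [B] as [t] drops by one, which
    preserves the hypothesis on [O]. *)
Lemma vsize_chain t o g B O : 0 < B -> o + t.+1 * B <= O ->
  vsize (enc_qfree (chain t o g B)) <=
  t * (vsize (enc_qfree g) * O.+1 + 2 * O + 60) + 20.
Proof.
move=> B0; elim: t o => [|t IH] o oO /=; first by rewrite trunc_log0 trunc_log1.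
have := IH (o + B); rewrite -addnA -mulSn => /(_ oO) {}IH.
have h1 : vsize (enc_qfree (shift_qfree o g)) <= vsize (enc_qfree g) * O.+1.
  rewrite -shift_val_qfree (leq_trans (vsize_shift _ _)) // leq_mul // ltnS.
  by apply: leq_trans oO; rewrite leq_addr.
have h2 : vsize (VInt (Posz (o + B + B.-1))) <= O + 2.
  by rewrite (leq_trans (vsize_nat _)) // leq_add2r; move: oO; rewrite !mulSn; lia.
have h3 : vsize (VInt (Posz (o + B.-1))) <= O + 2.
  by rewrite (leq_trans (vsize_nat _)) // leq_add2r; move: oO; rewrite !mulSn; lia.
move: h2 h3; rewrite mulSn /=.
by rewrite !trunc_log_small; lia.
Qed.

Lemma vsize_iter n f : vsize (enc_prenex (iter n PEx f)) = 3 * n + vsize (enc_prenex f).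
Proof. by elim: n => //= n ->; rewrite trunc_log_small; lia. Qed.

Lemma vsize_query t T g G B : 0 < B -> t <= T -> vsize (enc_qfree g) <= G ->
  vsize (enc_formula (query t g B)) <= query_size T G B.
Proof.
move=> B0 tT gG; rewrite /enc_formula /= vsize_iter /= !trunc_log_small /query_size.
have tB : t.+1 * B <= T.+1 * B by rewrite leq_mul2r ltnS tT orbT.
have h1 : vsize (enc_qfree (chain t 0 g B)) <=
    T * (G * (T.+1 * B).+1 + 2 * (T.+1 * B) + 60) + 20.
  apply: leq_trans (@vsize_chain t 0 g B (T.+1 * B) B0 tB) _.
  by rewrite leq_add2r leq_mul // !leq_add2r leq_mul.
lia.
Qed.

(** The lengths are tried from [t] downwards and the answers are positive exactly up to [c], so the
    descent stops at [minn t c]. *)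
Lemma ev_cnt t T g G B c r : 0 < B -> t <= T -> vsize (enc_qfree g) <= G ->
  (forall s, sat_oracle (enc_formula (query s g B)) = (s <= c)) ->
  evb [:: VPair (VInt (Posz t)) (VPair (enc_qfree g) (VInt (Posz B)))]
    (body counter 10) r (VInt (Posz (minn t c))) (t * query_cost T G B + 20) r.
Proof.
move=> B0 + gG oracle; elim: t => [|t IH] tT.
  by eapply evb_weaken; [evs; [reflexivity | evs] | rewrite min0n |].
have cost : 20 * t.+2 + 20 * (t.+2 * B) +
    t.+1 * (30 * vsize (enc_qfree g) + 200) + 200 +
    vsize (enc_formula (query t.+1 g B)) <= query_cost T G B.
  have := vsize_query B0 tT gG; rewrite /query_cost.
  have h1 : t.+2 * B <= T.+1 * B by rewrite leq_mul2r ltnS tT orbT.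
  have h2 : t.+1 * (30 * vsize (enc_qfree g) + 200) <= T * (30 * G + 200).
    by rewrite leq_mul // leq_add2r leq_mul2l.
  lia.
have run : evb [:: VPair (VInt (Posz t.+1)) (VPair (enc_qfree g) (VInt (Posz B)))]
    (EQuery (EPair (ELit 0)
            (ECall 8 (EPair (ECall 9 (EPair (EAdd arg1 (ELit 1)) arg22))
               (etag 0 (ECall 7 (EPair arg1 (EPair (ELit 0) arg2)))))))) r
    (vbool (t < c)) (query_cost T G B - 50) r.
  eapply evb_weaken; [evs | | ].
  - by rewrite /= -[(_ + _)%R]/(Posz (t.+1 + 1)) addn1.
  - exact: ev_mul.
  - reflexivity.
  - exact: (@ev_chain t.+1 0 g B).
  - exact: (erefl (VPair (VInt (Posz (t.+2 * B)))
      (enc_prenex (PMatrix (chain t.+1 0 g B))))).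
  - exact: ev_wrap.
  - by rewrite -[VPair _ _]/(enc_formula (query t.+1 g B)) oracle.
  - rewrite -[VPair _ _]/(enc_formula (query t.+1 g B)).
    by move: cost; lia.
have Q : 200 <= query_cost T G B by rewrite /query_cost; lia.
have [le|gt] := leqP t.+1 c.
  eapply evb_weaken; [eapply evb_if; [evs | exact: vtrue_leqS |
    eapply evb_if; [exact: run | | evs]] | | ].
  - by rewrite le.
  - evs.
  - by [].
  - by rewrite mulSn; lia.
have tc : (t < c) = false by rewrite ltnNge -ltnS gt.
eapply evb_weaken; [eapply evb_if; [evs | exact: vtrue_leqS |
    eapply evb_if; [exact: run | | evs]] | | ].
- by rewrite tc.
- evs.
- by rewrite /= predz.
- by apply: IH; rewrite ltnW.
- by rewrite (minn_idPr (gt : c <= t)).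
- by rewrite mulSn; lia.
Qed.

Lemma ev_level phi P a b T G w fuel j r : wf_formula phi -> 0 < P -> j + fuel <= w ->
  (forall i, i <= w -> vsize (enc_qfree (cell_qfree phi P a b (2 ^ i))) <= G) ->
  let n := size (fdoms phi) + nquant (fbody phi) in
  evb [:: VPair (VInt (Posz fuel)) (VPair (VInt (Posz (2 ^ j))) (VPair (VInt (Posz T))
         (VPair (enc_qfree (base_qfree phi P a b))
            (VPair (enc_term (hash_term P a b n n.+1))
               (VPair (VInt (Posz P)) (VInt (Posz (copy_size phi))))))))]
    (body counter 11) r
    (VInt (Posz (approx P T a b (packed_models phi) fuel (2 ^ j))))
    (fuel.+1 * (T * query_cost T G (copy_size phi) + 20 * T + 500)) r.
Proof.
move=> wfp P0 + GP n; elim: fuel j => [|fuel IH] j jw.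
  have gG := GP j (leq_trans (leq_addr 0 j) jw).
  have M0 : 0 < 2 ^ j by rewrite expn_gt0.
  have oracle s := sat_query_cell a b s wfp P0 M0.
  eapply evb_weaken; [evs | | ].
  (* The value assembled by the program is by computation the encoding of the cell formula of level
     [j]. *)
  - exact: (erefl (VPair (VInt (Posz T))
      (VPair (enc_qfree (cell_qfree phi P a b (2 ^ j))) (VInt (Posz (copy_size phi)))))).
  - exact: (ev_cnt r _ (leqnn T) gG oracle).
  - reflexivity.
  - evs; [reflexivity | exact: ev_mul].
  - by rewrite /=.
  - have := geq_minl T (count (in_cell P (2 ^ j) a b) (packed_models phi)).
    by move: (minn _ _) => m; lia.
have gG := GP j (leq_trans (leq_addr _ j) jw).
have M0 : 0 < 2 ^ j by rewrite expn_gt0.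
have oracle s := sat_query_cell a b s wfp P0 M0.
have IHj : j.+1 + fuel <= w by rewrite addSnnS.
have {}IH := IH j.+1 IHj; rewrite /=.
set c := minn T _.
have cT : c <= T by exact: geq_minl.
case Tc: (T <= c).
  eapply evb_weaken; [evs | | ].
  - exact: (erefl (VPair (VInt (Posz T))
      (VPair (enc_qfree (cell_qfree phi P a b (2 ^ j))) (VInt (Posz (copy_size phi)))))).
  - exact: (ev_cnt r _ (leqnn T) gG oracle).
  - exact: vtrue_leqS.
  - evs.
    + rewrite /= -/c lez_nat Tc; reflexivity.
    + evs.
      * by rewrite /= predz -PoszD addnn -mul2n -expnS.
      * exact: IH.
  - by rewrite addnn -mul2n -expnS.
  - by rewrite [fuel.+2 * _]mulSn; lia.
eapply evb_weaken; [evs | | ].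
- exact: (erefl (VPair (VInt (Posz T))
      (VPair (enc_qfree (cell_qfree phi P a b (2 ^ j))) (VInt (Posz (copy_size phi)))))).
- exact: (ev_cnt r _ (leqnn T) gG oracle).
- exact: vtrue_leqS.
- evs.
  + rewrite /= -/c lez_nat Tc; reflexivity.
  + by evs; [reflexivity | exact: ev_mul].
- by [].
- by rewrite -/c [fuel.+2 * _]mulSn; lia.
Qed.

(** * Running time *)

(** Domain bounds are written in binary, so the width, and with it the number of levels, is at most
    linear in the size of the formula. *)
Lemma nbits_size (x y : int) : nbits (y - x)%R <= vsize (VInt x) + vsize (VInt y).
Proof.
rewrite /nbits; case: ifP => // _; apply: up_log_min => //.
have hx : absz x < 2 ^ (trunc_log 2 (absz x)).+1 by rewrite trunc_log_ltn.
have hy : absz y < 2 ^ (trunc_log 2 (absz y)).+1 by rewrite trunc_log_ltn.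
have le : 2 ^ (trunc_log 2 (absz x)).+1 * 2 ^ (trunc_log 2 (absz y)).+1 <=
    2 ^ (vsize (VInt x) + vsize (VInt y)).
  by rewrite -expnD leq_exp2l //= leq_add.
apply: leq_trans le; have : absz (y - x)%R <= absz x + absz y by lia.
move: hx hy; set u := 2 ^ _; set v := 2 ^ _; move: u v => u v; nia.
Qed.

Lemma width_size ds : width ds <= vsize (enc_doms ds).
Proof.
by elim: ds => //= d ds IH; have := nbits_size d.1 d.2; rewrite /=; lia.
Qed.

Lemma size_doms_size ds : size ds <= vsize (enc_doms ds).
Proof. by elim: ds => //= d ds IH; lia. Qed.

Lemma nquant_size f : nquant f + vsize (enc_qfree (matrix_of f)) <= vsize (enc_prenex f).
Proof. by elim: f => [g|g IH] /=; lia. Qed.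

Lemma vsize_dom i ds m : i + size ds <= m ->
  vsize (enc_qfree (dom_qfree i ds)) <= size ds * (2 * m + 40) + vsize (enc_doms ds) + 20.
Proof.
elim: ds i => [|d ds IH] i /=; first by rewrite !trunc_log_small; lia.
rewrite addnS -addSn => im; have := IH _ im.
have := vsize_nat i; rewrite /= !trunc_log_small; lia.
Qed.

Lemma vsize_pack i ds m : i + size ds <= m ->
  vsize (enc_term (pack_term i ds)) <=
  size ds * (m + 40) + vsize (enc_doms ds) + width ds + 10.
Proof.
elim: ds i => [|d ds IH] i /=; first by rewrite !trunc_log_small; lia.
rewrite addnS -addSn => im; have := IH _ im.
have := vsize_nat i; rewrite /= trunc_expnK // !trunc_log_small; lia.
Qed.

Definition cell_size (s : nat) : nat := s * (3 * s + 200) + 300.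

Lemma vsize_cell phi a b i s : let L := (width (fdoms phi) + width (fdoms phi)).+1 in
  formula_size phi <= s -> a < 2 ^ L -> b < 2 ^ L -> i <= width (fdoms phi) ->
  vsize (enc_qfree (cell_qfree phi (2 ^ L) a b (2 ^ i))) <= cell_size s.
Proof.
case: phi => ds f; rewrite /formula_size /=.
have := width_size ds; have := size_doms_size ds; have := nquant_size f.
set k := size ds; set q := nquant f; set w := width ds.
move=> fs ks ws ss al bl iw.
have km : 0 + k <= s by lia.
have hd := vsize_dom km; have hp := vsize_pack km.
have ha := vsize_lt al; have hb := vsize_lt bl.
have hn := vsize_nat (k + q); have hy := vsize_nat (k + q).+1.
move: ha hb hn hy; rewrite /= !trunc_expnK // !trunc_log_small => ha hb hn hy.
rewrite -/k -/w in hd hp.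
have h1 : k * (2 * s + 40) <= s * (2 * s + 40) by rewrite leq_mul2r; lia.
have h2 : k * (s + 40) <= s * (s + 40) by rewrite leq_mul2r; lia.
rewrite /cell_size; lia.
Qed.

Lemma leq_query_cost T T' G G' B B' : T <= T' -> G <= G' -> B <= B' ->
  query_cost T G B <= query_cost T' G' B'.
Proof.
by move=> TT GG BB; rewrite /query_cost /query_size;
  do !apply: leq_add => //; do ![apply: leq_mul => //=; rewrite ?ltnS];
  do !apply: leq_add => //; do ![apply: leq_mul => //=; rewrite ?ltnS];
  do !apply: leq_add => //; do ![apply: leq_mul => //=; rewrite ?ltnS].
Qed.

(** With [s] bounding the formula size plus [e]: at most [s + 1] levels, each with at most
    [32 s ^ 2] queries and a multiplication by repeated addition. *)
Definition run_cost (s : nat) : nat :=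
  s.+1 * (32 * (s * s) * query_cost (32 * (s * s)) (cell_size s) (s + 2)
          + 20 * (32 * (s * s)) + 500) + 1000 * s + 2000.

Definition output (phi : formula) (e a b : nat) : nat :=
  let w := width (fdoms phi) in
  approx (2 ^ (w + w).+1) (32 * (e * e)) a b (packed_models phi) w 1.

Lemma ev_main phi (eps : rat) (n s : nat) r :
  let L := (width (fdoms phi) + width (fdoms phi)).+1 in
  wf_formula phi -> formula_size phi + n.+2 <= s -> L + L <= size r ->
  (forall i, i < n -> (numq eps + numq eps * Posz i < denq eps)%R) ->
  (denq eps <= numq eps + numq eps * Posz n)%R ->
  evb [:: enc_input phi eps] (body counter 0) r
    (VPair (VInt (Posz (output phi n.+2 (bits L r) (bits L (drop L r))))) (VInt 1))
    (run_cost s) (drop L (drop L r)).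
Proof.
move=> L wfp ss Lr lt ge.
have s1 : width (fdoms phi) <= formula_size phi.
  by have := width_size (fdoms phi); rewrite /formula_size /=; lia.
have s2 : size (fdoms phi) + nquant (fbody phi) <= formula_size phi.
  have := size_doms_size (fdoms phi); have := nquant_size (fbody phi).
  by rewrite /formula_size /=; lia.
have size1 : L <= size r by apply: leq_trans Lr; rewrite leq_addr.
have size2 : L <= size (drop L r) by rewrite size_drop leq_subRL.
have P0 : 0 < 2 ^ L by rewrite expn_gt0.
set a := bits L r; set b := bits L (drop L r).
have GP i : i <= width (fdoms phi) ->
    vsize (enc_qfree (cell_qfree phi (2 ^ L) a b (2 ^ i))) <= cell_size s.
  apply: vsize_cell; rewrite ?bits_lt //.
  by apply: leq_trans ss; rewrite leq_addr.
eapply evb_weaken; [evs | | ].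
- reflexivity.
- exact: (ev_pack 0).
- reflexivity.
- exact: ev_strip.
- by rewrite /= -!PoszD addn1.
- exact: (ev_rnd size1).
- by rewrite /= -!PoszD addn1.
- exact: (ev_rnd size2).
- by rewrite /= -!PoszD addn1.
- exact: ev_pow2.
- reflexivity.
- exact: (ev_ceil 1 _ lt ge).
- rewrite /= -!PoszD !addn1 add1n; reflexivity.
- exact: ev_mul.
- reflexivity.
- exact: ev_mul.
- cbn [nth vfst vsnd vint]; rewrite -!PoszD !add0n !addn1 addn2.
  exact: (erefl (VPair (VInt (Posz (width (fdoms phi)))) (VPair (VInt (Posz (2 ^ 0)))
    (VPair (VInt (Posz (32 * (n.+2 * n.+2)))) (VPair (enc_qfree (base_qfree phi (2 ^ L) a b))
    (VPair (enc_term (hash_term (2 ^ L) a b (size (fdoms phi) + nquant (fbody phi))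
                                (size (fdoms phi) + nquant (fbody phi)).+1))
    (VPair (VInt (Posz (2 ^ L))) (VInt (Posz (copy_size phi)))))))))).
- exact: (@ev_level phi (2 ^ L) a b (32 * (n.+2 * n.+2)) (cell_size s)
    (width (fdoms phi)) (width (fdoms phi)) 0 _ wfp P0 (leqnn _) GP).
- by [].
- have Q : query_cost (32 * (n.+2 * n.+2)) (cell_size s) (copy_size phi) <=
      query_cost (32 * (s * s)) (cell_size s) (s + 2).
    have ns : n.+2 <= s by lia.
    apply: leq_query_cost => //; last by rewrite /copy_size -addn2 leq_add2r; lia.
    by rewrite leq_mul // leq_mul.
  set C := _.+1 * (_ + _ + 500).
  have HC : C <= s.+1 * (32 * (s * s) * query_cost (32 * (s * s)) (cell_size s) (s + 2)
          + 20 * (32 * (s * s)) + 500).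
    have ns : n.+2 <= s by lia.
    have ee : 32 * (n.+2 * n.+2) <= 32 * (s * s) by rewrite leq_mul // leq_mul.
    rewrite /C leq_mul //; first by lia.
    by rewrite leq_add2r leq_add ?leq_mul.
  move: C HC => C HC; rewrite /run_cost; lia.
Qed.

Lemma output_correct phi (e : nat) : 0 < e ->
  let P := 2 ^ (width (fdoms phi) + width (fdoms phi)).+1 in
  3 * (P * P) <= 4 * #|[set c : 'I_P * 'I_P |
    e * dist (output phi e c.1 c.2) (model_count phi) <= model_count phi]|.
Proof.
move=> e0; rewrite /output.
(* The modulus is at least 2, so it has the form [p.+2] for which the residues form a ring. *)
have [p pE] : exists p, p.+2 = 2 ^ (width (fdoms phi) + width (fdoms phi)).+1.
  exists (2 ^ (width (fdoms phi) + width (fdoms phi)).+1).-2.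
  have : 0 < 2 ^ (width (fdoms phi) + width (fdoms phi)) by rewrite expn_gt0.
  by rewrite expnS; lia.
rewrite -pE -(size_packed_models phi); apply: (approx_correct pE _ _ e0).
  exact: packed_models_uniq.
exact: packed_models_lt.
Qed.

(** * Polynomial bounds and accuracy *)

Local Open Scope ring_scope.

(** The bound is required at every rational [x] above [s] because the polynomial is evaluated at a
    rational number that only bounds [s]. *)
Definition poly_bounded (f : nat -> nat) : Prop :=
  exists p : {poly rat}, forall (s : nat) (x : rat), s%:R <= x -> (f s)%:R <= p.[x].

Lemma poly_bounded_id : poly_bounded id.
Proof. by exists 'X => s x; rewrite hornerX. Qed.

Lemma poly_bounded_const c : poly_bounded (fun=> c).
Proof. by exists c%:R%:P => s x _; rewrite hornerC. Qed.

Lemma poly_bounded_add f g : poly_bounded f -> poly_bounded g ->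
  poly_bounded (fun s => f s + g s)%N.
Proof.
by move=> [p hp] [q hq]; exists (p + q) => s x sx; rewrite hornerD natrD lerD ?hp ?hq.
Qed.

Lemma poly_bounded_mul f g : poly_bounded f -> poly_bounded g ->
  poly_bounded (fun s => f s * g s)%N.
Proof.
move=> [p hp] [q hq]; exists (p * q) => s x sx.
by rewrite hornerM natrM ler_pM ?ler0n ?hp ?hq.
Qed.

Lemma poly_bounded_succ f : poly_bounded f -> poly_bounded (fun s => (f s).+1).
Proof.
move=> hf; have [p hp] := poly_bounded_add (poly_bounded_const 1) hf.
by exists p => s x /hp; rewrite add1n.
Qed.

Lemma run_cost_poly : poly_bounded run_cost.
Proof.
rewrite /run_cost /query_cost /query_size /cell_size.
by repeat first [exact: poly_bounded_id | exact: poly_bounded_const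
  | apply: poly_bounded_add | apply: poly_bounded_mul | apply: poly_bounded_succ].
Qed.

(** Since [1 / e <= eps], the factor [1 - 1 / (e + 1)], which is [1 / (1 + 1 / e)], is at least
    [1 / (1 + eps)]; this is why the accuracy parameter exceeds the rounded-up [1 / eps] by one. *)
Lemma approx_ratio (e o N : nat) (eps : rat) : 1 <= e%:R * eps ->
  (e.+1 * dist o N <= N)%N ->
  (1 + eps)^-1 * N%:R <= o%:R <= (1 + eps) * N%:R.
Proof.
move=> e1 d.
have e0 : 0 < (e%:R : rat).
  by rewrite ltr0n lt0n; apply/eqP => E; move: e1; rewrite E mul0r ler10.
have eps0 : 0 < eps by rewrite -(pmulr_rgt0 _ e0); lra.
have hi : (e.+1 * o <= e.+2 * N)%N by move: d; rewrite /dist; nia.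
have lo : (e * N <= e.+1 * o)%N by move: d; rewrite /dist; nia.
move: hi lo; rewrite -!(ler_nat rat) !natrM -!natr1 => hi lo.
have o0 : 0 <= (o%:R : rat) by rewrite ler0n.
have N0 : 0 <= (N%:R : rat) by rewrite ler0n.
have eN : (N%:R : rat) <= e%:R * eps * N%:R by rewrite ler_peMl.
apply/andP; split.
  rewrite mulrC ler_pdivrMr; last by lra.
  have k : 0 < (e%:R + 1 : rat) by lra.
  rewrite -(ler_pM2r k).
  have : e%:R * N%:R * (1 + eps) <= (e%:R + 1) * o%:R * (1 + eps).
    by rewrite ler_wpM2r //; lra.
  nra.
have k : 0 < (e%:R + 1 : rat) by lra.
rewrite -(ler_pM2l k); have : 0 <= eps * N%:R by rewrite mulr_ge0 // ltW.
nra.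
Qed.

(** Here [n + 1] is [1 / eps] rounded up; the first two conditions describe the loop of the program,
    the third serves the accuracy and the last the running time. *)
Lemma ceil_inv (eps : rat) : 0 < eps -> exists n : nat,
  [/\ forall i, (i < n)%N -> (numq eps + numq eps * Posz i < denq eps)%R,
      (denq eps <= numq eps + numq eps * Posz n)%R,
      1 <= n.+1%:R * eps & n%:R <= eps^-1].
Proof.
move=> eps0; have num0 : 0 < numq eps by rewrite numq_gt0.
have den0 := denq_gt0 eps.
have ex : exists n, denq eps <= numq eps + numq eps * Posz n.
  by exists (absz (denq eps)); rewrite gez0_abs ?ltW //; nia.
case: (ex_minnP ex) => n nP nmin; exists n.
have epsE : eps * (denq eps)%:~R = (numq eps)%:~R by rewrite -numqE.
have den0' : 0 < (denq eps)%:~R :> rat by rewrite ltr0z.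
split=> // [i ni||].
- by rewrite ltNge; apply: contraL ni => /nmin; rewrite -leqNgt.
- rewrite -(ler_pM2r den0') mul1r -mulrA epsE -natr1 mulrDl mul1r.
  move: nP; rewrite -(ler_int rat) rmorphD rmorphM /= -pmulrn; lra.
rewrite -[X in _ <= X]mul1r ler_pdivlMr // -(ler_pM2r den0') mul1r -mulrA epsE.
case: n nP nmin => [|n] nP nmin; first by rewrite mul0r ltW.
have : (numq eps + numq eps * Posz n < denq eps)%R.
  by rewrite ltNge; apply/negP => /nmin; rewrite ltnn.
rewrite -(ltr_int rat) rmorphD rmorphM /= -pmulrn -natr1; lra.
Qed.

Theorem theorem1 :
  exists (A : program) (p : {poly rat}),
  forall (phi : formula) (eps : rat), wf_formula phi -> 0 < eps ->
  exists T : nat,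
    [/\ T%:R <= p.[(formula_size phi)%:R + eps^-1],
        forall r : T.-tuple bool,
          exists (q : rat) (t : nat), run A phi eps r q t /\ (t <= T)%N
      & 3%:R / 4%:R <=
        prob_coins T (fun r => exists (q : rat) (t : nat),
          run A phi eps r q t /\
          (1 + eps)^-1 * (model_count phi)%:R <= q
            <= (1 + eps) * (model_count phi)%:R)].
Proof.
have [p hp] := run_cost_poly.
(* Since [n <= 1 / eps], the parameter [s] below is at most the prescribed argument plus 2. *)
exists counter, (p \Po ('X + 2%:R%:P)) => phi eps wfp eps0.
have [n [lt ge ne nle]] := ceil_inv eps0.
pose s := (formula_size phi + n.+2)%N.
pose L := (width (fdoms phi) + width (fdoms phi)).+1.
have LT : (L + L <= run_cost s)%N.
  have := width_size (fdoms phi); rewrite /L /run_cost /s /formula_size /=.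
  by move: (_.+1 * (_ + _ + 500))%N => C; lia.
(* The number of tosses provided equals the bound on the running time; [T'] of them are left
   unread. *)
pose T' := (run_cost s - (L + L))%N.
have TE : (L + (L + T'))%N = run_cost s by rewrite addnA subnKC.
pose out (r : seq bool) := output phi n.+2 (bits L r) (bits L (drop L r)).
have main (r : (L + (L + T')).-tuple bool) : exists2 t, (t <= run_cost s)%N &
    run counter phi eps r (out r)%:R t.
  have Lr : (L + L <= size r)%N by rewrite size_tuple addnA leq_addr.
  have [t ht tT] := ev_main wfp (leqnn s) Lr lt ge.
  exists t => //; exists (VPair (VInt (Posz (out r))) (VInt 1)).
  eexists; split; first exact: ht.
  by eexists; eexists; split; [reflexivity | | rewrite divr1].
exists (L + (L + T'))%N; split.
- rewrite TE horner_comp; apply: hp.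
  rewrite hornerD hornerX hornerC /s natrD -addn2 natrD addrA lerD2r lerD2l //.
- by move=> r; have [t tT ht] := main r; exists (out r)%:R, t; split=> //; rewrite TE.
rewrite /prob_coins.
pose G (a b : nat) :=
  (n.+2 * dist (output phi n.+2 a b) (model_count phi) <= model_count phi)%N.
have sub : [set r : (L + (L + T')).-tuple bool | G (bits L r) (bits L (drop L r))] \subset
  [set r : (L + (L + T')).-tuple bool | `[< exists (q : rat) (t : nat),
          run counter phi eps r q t /\
          (1 + eps)^-1 * (model_count phi)%:R <= q
            <= (1 + eps) * (model_count phi)%:R >]].
  apply/subsetP => r; rewrite !inE => Gr; apply/asboolP.
  have [t _ ht] := main r; exists (out r)%:R, t.
  by split=> //; exact: approx_ratio ne Gr.
(* The unread tosses multiply both the good and the total number by [2 ^ T'], so the proportion is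
   that of the good pairs. *)
have := subset_leq_card sub; rewrite card_bits2.
have := @output_correct phi n.+2 isT; rewrite -/L -/(G _ _).
move=> h1 h2; rewrite ler_pdivlMr ?exprn_gt0 // mulrAC ler_pdivrMr //.
rewrite -natrX -!natrM ler_nat.
apply: leq_trans (leq_mul h2 (leqnn 4)).
rewrite [X in (_ <= X)%N]mulnC mulnA.
by apply: leq_trans (leq_mul h1 (leqnn _)); rewrite !expnD !mulnA.
Qed.
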